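(* Let $\Gamma_0=\mathbb R\times\mathbb R_*$, $F\in\mathcal D(\Gamma_0\times\Gamma_0)$ and $f\in\mathcal D(\Gamma_0)$. There exists $\epsilon>0$ such that for $|s|\le\epsilon$ the function $\widehat{\delta_s}(f)F$ belongs to $\mathcal D(\Gamma_0\times\Gamma_0)$ and is supported in a fixed compact set, and $$\lim_{s\to0}\big(\widehat{\delta_s}(f)F-\widehat{\delta_0}(f)F\big)=0\quad\text{in } C^*_r(\Gamma_0\times\Gamma_0)=C^*_r(\Gamma_0)\otimes C^*_r(\Gamma_0).$$
   Context: $\mathbb R_*=\mathbb R\setminus\{0\}$; $\mathcal D(M)$ = smooth compactly supported complex functions on $M$. For $s\in\mathbb R$, $$(\widehat{\delta_s}(f)F)(b_1,a_1,b_2,a_2)=\int\frac{db}{|1+sb|}\,f\big(b,\,sb+(a_1-sb_1)(a_2-sb_2)\big)\,F\Big(\frac{b_1-b}{1+sb},\frac{a_1}{1+sb},\frac{-b+b_2(a_1-sb_1)}{a_1-sb_1+sb},\frac{a_2(a_1-sb_1)}{a_1-sb_1+sb}\Big),$$ the integrand being understood as $0$ where an argument is undefined or lies outside $\Gamma_0$; for $s=0$: $(\widehat{\delta_0}(f)F)(b_1,a_1,b_2,a_2)=\int db\,f(b,a_1a_2)F(b_1-b,a_1,b_2-\frac b{a_1},a_2)$. $\Gamma_0$ is regarded as the groupoid over $\mathbb R_*$ that is the trivial bundle of additive groups $\mathbb R$ (coordinate $b$ in the group, $a$ in the base). $C^*_r(\Gamma_0)$ is the completion of $\mathcal D(\Gamma_0)$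 with product $(f*g)(b,a)=\int dc\,f(c,a)g(b-c,a)$ in the operator norm of $g\mapsto f*g$ on $L^2(\mathbb R\times\mathbb R_*,db\,da/a^2)$; $C^*_r(\Gamma_0\times\Gamma_0)$ is defined analogously using convolution in both variables $b_1,b_2$. *)

(* Defs.v *)
From HB Require Import structures.
From mathcomp Require Import all_boot all_order all_algebra.
From mathcomp Require Import complex.
From mathcomp Require Import all_classical all_reals all_analysis.

Set Implicit Arguments.
Unset Strict Implicit.
Unset Printing Implicit Defensive.

Import Order.TTheory GRing.Theory Num.Theory.
Import numFieldNormedType.Exports.

Local Open Scope classical_set_scope.
Local Open Scope ring_scope.

(* Points of Gamma_0 are pairs (b, a), points of Gamma_0 x Gamma_0 are
   ((b1, a1), (b2, a2)).  A function on an open set U is represented by a total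
   function of which only the values on U matter: no definition below looks at
   the values of such a function outside U. *)
Definition Gamma0 (R : realType) : set (R * R) := [set p | p.2 != 0].

Definition Gamma00 (R : realType) : set ((R * R) * (R * R)) :=
  @Gamma0 R `*` @Gamma0 R.

(* C^k on the open set U.  In finite dimension, C^(k+1) amounts to (Frechet)
   differentiability together with every directional derivative being C^k. *)
Fixpoint Ck (R : realType) (V : normedModType R) (U : set V) (k : nat)
    (h : V -> R) : Prop :=
  if k is k'.+1 then
    (forall x, U x -> differentiable h x) /\
    (forall v : V, Ck U k' (fun x => 'D_v h x))
  else forall x, U x -> {for x, continuous h}.

Definition smooth_on (R : realType) (V : normedModType R) (U : set V)
    (h : V -> R[i]) : Prop :=
  forall k, Ck U k (fun x => complex.Re (h x)) /\
            Ck U k (fun x => complex.Im (h x)).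

Definition vanishes_off (R : realType) (V : normedModType R) (U K : set V)
    (h : V -> R[i]) : Prop :=
  forall x, U x -> ~ K x -> h x = 0.

(* The space D(U) of smooth compactly supported functions on the open set U. *)
Definition test_function (R : realType) (V : normedModType R) (U : set V)
    (h : V -> R[i]) : Prop :=
  smooth_on U h /\
  exists K : set V, [/\ compact K, K `<=` U & vanishes_off U K h].

(* The library's sigma-finiteness instance for products is masked by the one
   for subprobabilities, hence the explicit proof. *)
Lemma product_sigma_finite d1 d2 (T1 : measurableType d1)
    (T2 : measurableType d2) (R : realType)
    (m1 : {sigma_finite_measure set T1 -> \bar R})
    (m2 : {sigma_finite_measure set T2 -> \bar R}) :
  sigma_finite setT (m1 \x m2)%E.
Proof.
have /sigma_finiteP[F [TF ndF Foo]] := sigma_finiteT m1.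
have /sigma_finiteP[G [TG ndG Goo]] := sigma_finiteT m2.
exists (fun n => F n `*` G n).
  rewrite -setXTT TF TG predeqE => -[x y]; split; last first.
    by move=> [n _ []/= Fx Gy]; split; exists n.
  move=> [/= [n _ Fnx] [k _ Gky]]; exists (maxn n k) => //; split.
    by move: x Fnx; exact/subsetPset/ndF/leq_maxl.
  by move: y Gky; exact/subsetPset/ndG/leq_maxr.
move=> k; have [mF Foo'] := Foo k; have [mG Goo'] := Goo k.
split; first exact: measurableX.
by rewrite product_measure1E// lte_mul_pinfty// ge0_fin_numE.
Qed.

Definition leb2 {R : realType} :
    set (measurableTypeR R * measurableTypeR R)%type -> \bar R :=
  (@lebesgue_measure R \x @lebesgue_measure R)%E.

HB.instance Definition _ (R : realType) := Measure.on (@leb2 R).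

HB.instance Definition _ (R : realType) :=
  Measure_isSigmaFinite.Build _ _ _ (@leb2 R)
    (product_sigma_finite (@lebesgue_measure R) (@lebesgue_measure R)).

Definition leb4 {R : realType} :
    set ((measurableTypeR R * measurableTypeR R) *
         (measurableTypeR R * measurableTypeR R))%type -> \bar R :=
  (@leb2 R \x @leb2 R)%E.

HB.instance Definition _ (R : realType) := Measure.on (@leb4 R).

HB.instance Definition _ (R : realType) :=
  Measure_isSigmaFinite.Build _ _ _ (@leb4 R)
    (product_sigma_finite (@leb2 R) (@leb2 R)).

Definition Cintegral (R : realType) (d : measure_display)
    (T : measurableType d) (mu : {measure set T -> \bar R})
    (h : T -> R[i]) : R[i] :=
  ((\int[mu]_x complex.Re (h x)) +i* (\int[mu]_x complex.Im (h x)))%C.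

Definition normsq (R : realType) (z : R[i]) : R :=
  complex.Re z ^+ 2 + complex.Im z ^+ 2.

(* The squared norm of L^2(Gamma_0 x Gamma_0, db1 da1/a1^2 db2 da2/a2^2). *)
Definition L2sq (R : realType) (g : (R * R) * (R * R) -> R[i]) : \bar R :=
  (\int[@leb4 R]_(p in @Gamma00 R)
     (normsq (g p) / (p.1.2 ^+ 2 * p.2.2 ^+ 2))%:E)%E.

Definition L2fun (R : realType) (g : (R * R) * (R * R) -> R[i]) : Prop :=
  [/\ measurable_fun (@Gamma00 R) (fun p => complex.Re (g p)),
      measurable_fun (@Gamma00 R) (fun p => complex.Im (g p)) &
      (L2sq g < +oo)%E].

Definition conv (R : realType) (h g : (R * R) * (R * R) -> R[i])
    (p : (R * R) * (R * R)) : R[i] :=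
  Cintegral (@leb2 R) (fun c : R * R =>
    h ((c.1, p.1.2), (c.2, p.2.2)) *
    g ((p.1.1 - c.1, p.1.2), (p.2.1 - c.2, p.2.2))).

(* The norm of C*_r(Gamma_0 x Gamma_0) on D(Gamma_0 x Gamma_0): the operator
   norm of g |-> h * g on L^2. *)
Definition cstar_norm (R : realType) (h : (R * R) * (R * R) -> R[i]) : \bar R :=
  ereal_inf [set C%:E | C in [set C : R | 0 <= C /\
    forall g, L2fun g -> (L2sq (conv h g) <= (C ^+ 2)%:E * L2sq g)%E]].

(* h lies in the tensor product C*_r(Gamma_0) (x) C*_r(Gamma_0).  As
   L^2(Gamma_0) (x) L^2(Gamma_0) = L^2(Gamma_0 x Gamma_0), and as u (x) v acts
   there as convolution by (p1, p2) |-> u p1 * v p2, this (spatial) tensor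
   product is the closure, in the operator norm on L^2(Gamma_0 x Gamma_0), of
   the algebraic tensor product of the dense subalgebras D(Gamma_0). *)
Definition in_cstar_tensor (R : realType) (h : (R * R) * (R * R) -> R[i]) :
    Prop :=
  forall e : R, 0 < e ->
  exists (n : nat) (u v : 'I_n -> R * R -> R[i]),
    [/\ forall i, test_function (@Gamma0 R) (u i),
        forall i, test_function (@Gamma0 R) (v i) &
        (cstar_norm (fun p => (h p - \sum_(i < n) u i p.1 * v i p.2)%R)
           <= e%:E)%E].

Definition delta_integrand (R : realType) (s : R) (f : R * R -> R[i])
    (F : (R * R) * (R * R) -> R[i]) (p : (R * R) * (R * R)) (b : R) : R[i] :=
  let b1 := p.1.1 in let a1 := p.1.2 in
  let b2 := p.2.1 in let a2 := p.2.2 in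
  let x := (b, s * b + (a1 - s * b1) * (a2 - s * b2)) in
  let y1 := ((b1 - b) / (1 + s * b), a1 / (1 + s * b)) in
  let y2 := ((- b + b2 * (a1 - s * b1)) / (a1 - s * b1 + s * b),
             a2 * (a1 - s * b1) / (a1 - s * b1 + s * b)) in
  if [&& 1 + s * b != 0, a1 - s * b1 + s * b != 0,
         x \in @Gamma0 R, y1 \in @Gamma0 R & y2 \in @Gamma0 R]
  then (`|1 + s * b|^-1)%:C%C * f x * F (y1, y2)
  else 0.

Definition delta_hat (R : realType) (s : R) (f : R * R -> R[i])
    (F : (R * R) * (R * R) -> R[i]) (p : (R * R) * (R * R)) : R[i] :=
  Cintegral (@lebesgue_measure R) (delta_integrand s f F p).

Lemma delta_hat0 (R : realType) (f : R * R -> R[i])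
    (F : (R * R) * (R * R) -> R[i]) (b1 a1 b2 a2 : R) :
  a1 != 0 -> a2 != 0 ->
  delta_hat 0 f F ((b1, a1), (b2, a2)) =
  Cintegral (@lebesgue_measure R) (fun b =>
    f (b, a1 * a2) * F ((b1 - b, a1), (b2 - b / a1, a2))).
Proof.
move=> a1_neq0 a2_neq0; rewrite /delta_hat; congr (Cintegral _ _).
apply/funext => b; rewrite /delta_integrand/= !mul0r !addr0 !subr0 add0r.
rewrite oner_eq0 a1_neq0 !divr1 mulfK//= !mem_set ?/Gamma0/= ?mulf_neq0//.
by rewrite normr1 invr1 mul1r mulrDl mulfK// mulNr [- (b / a1) + _]addrC.
Qed.

(* Main.v *)
From HB Require Import structures.
Require Import Defs.
From mathcomp Require Import all_boot all_order all_algebra.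
From mathcomp Require Import complex.
From mathcomp Require Import all_classical all_reals all_analysis.
From mathcomp Require Import measurable_realfun.
From mathcomp Require Import ring lra.

Set Implicit Arguments.
Unset Strict Implicit.
Unset Printing Implicit Defensive.

Import Order.TTheory GRing.Theory Num.Theory.
Import numFieldNormedType.Exports.

Local Open Scope classical_set_scope.
Local Open Scope ring_scope.

(** Let m <= 1 <= M be such that the supports of f and F lie where |b| <= M and
    m <= |a| <= M in every pair of variables. Extended by zero, f and F are
    smooth on the whole space, and the integrand of delta_hat becomes one
    function of (s, p, b) with p = (b1, a1, b2, a2). Solving the arguments of F
    for p shows that, for |s| <= m^2 / (64 M), this function vanishes unless
    |b| <= M and p lies in a fixed compact set K, and that on this set both
    denominators 1 + s b and a1 - s b1 + s b stay away from zero
    (delta_args_bounds, delta_denom). Hence it is smooth jointly in (s, p, b)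
    (Ck_delta_kernel), and differentiation under the integral sign makes
    delta_hat smooth jointly in (s, p) (Ck_integral).

    Treating s as one more variable settles the first two assertions at once.
    Slices at a fixed s are test functions with support in K. Continuity at the
    points (0, p) together with compactness of K gives uniform convergence of
    delta_hat s f F to delta_hat 0 f F as s tends to 0 (delta_hat_uniform).

    Uniform convergence with supports in K is enough, because a function whose
    real and imaginary parts are bounded by eta and which is supported in |b1|,
    |b2| <= B has norm at most 8 eta B^2 (cstar_norm_le): convolution by it is
    dominated by eta times the integral over the box of the translates in b1,
    b2, whose L^2 norms are all equal. This is Cauchy-Schwarz, Tonelli and
    translation invariance; the variables a1, a2 of the base are only carried
    along.

    By the same estimate the last assertion becomes a uniform approximation of
    a test function by sums of products u(p1) v(p2) with supports in a fixed
    compact set. Products of one-variable bumps from a fine smooth partition of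
    unity, weighted by the values of the function at the grid points, do this
    (sum_bump, grid_approx_le). The bumps are differences of two consecutive
    translates of a smooth step made from exp(-1/t), so that their sum
    telescopes to 1.

    Membership in C^k is defined through all iterated directional derivatives;
    in the chain rule the direction depends on the point, so it is expanded in
    a basis (coords, Ck_comp). *)

(** * Calculus of functions of class C^k *)

Section Ck_calculus.
Context {R : realType} {V : normedModType R}.
Implicit Types (U W : set V) (h g : V -> R) (k : nat).

Lemma Ck_subset U W k h : W `<=` U -> Ck U k h -> Ck W k h.
Proof.
elim: k h => [|k IH] h WU /=; first by move=> c x /WU; exact: c.
by move=> [d c]; split=> [x /WU|v]; [exact: d|exact: IH].
Qed.

(** Near a point of the open set U the functions agree, and differentials and
    directional derivatives at that point depend on nothing else. *)
Lemma Ck_ext U k h g : open U -> (forall x, U x -> h x = g x) ->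
  Ck U k h -> Ck U k g.
Proof.
move=> oU; have near_hg h' g' : (forall x, U x -> h' x = g' x) ->
    forall x, U x -> \forall y \near x, h' y = g' y.
  move=> hg x Ux; have := open_nbhs_nbhs (conj oU Ux).
  by apply: filterS => y; exact: hg.
elim: k h g => [|k IH] h g hg /=.
  move=> ch x Ux; rewrite /prop_for /continuous_at -(hg _ Ux).
  by apply: cvg_trans (ch x Ux); apply: near_eq_cvg; exact: near_hg.
move=> [dh Dh]; split=> [x Ux|v].
  have hgx := near_hg _ _ hg x Ux.
  have /diff_locallyxP[cd E] := dh x Ux.
  have gx : g \o shift x = cst (g x) + 'd h x +o_ 0 id.
    have /diff_locallyP[_ E'] := dh x Ux.
    apply/eqaddoP => e e0.
    move/eqaddoP : E' => /(_ e e0); move: hgx.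
    rewrite (near_shift 0 x) subr0; apply: filterS2 => y /= hgy.
    by rewrite !fctE /= -hgy -(hg _ Ux).
  have -> : differentiable g x <-> continuous ('d g x) /\
     (g \o shift x = cst (g x) + 'd g x +o_ 0 id) by exact: diff_locallyP.
  by rewrite (diff_unique cd gx).
by apply: IH (Dh v) => x Ux; apply: near_eq_derive; exact: near_hg.
Qed.

(** The conditions defining C^k are imposed point by point, so regularity can be
    checked on the pieces of a cover, with a different reason on each piece. *)
Lemma Ck_union U W k h : Ck U k h -> Ck W k h -> Ck (U `|` W) k h.
Proof.
elim: k h => [|k IH] h /=; first by move=> cU cW x [/cU|/cW].
move=> [dU DU] [dW DW]; split=> [x [/dU|/dW]//|v]; exact: IH.
Qed.

Lemma Ck_pred U k h : Ck U k.+1 h -> Ck U k h.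
Proof.
elim: k h => [|k IH] h.
  by move=> [d _] x /d; exact: differentiable_continuous.
move=> [d D]; split=> [//|v]; exact: IH (D v).
Qed.

Lemma Ck_le U k j h : (j <= k)%N -> Ck U k h -> Ck U j h.
Proof.
elim: k => [|k IH]; first by rewrite leqn0 => /eqP ->.
rewrite leq_eqVlt => /predU1P[->//|jk] /Ck_pred; exact: IH.
Qed.

Lemma Ck_cst U k (a : R) : Ck U k (fun=> a).
Proof.
elim: k a => [|k IH] a /=; first by move=> x _; exact: cvg_cst.
split=> [x _|v]; first exact: differentiable_cst.
rewrite (_ : 'D_v _ = fun=> 0); first exact: IH.
by apply/funext => x; rewrite derive_cst.
Qed.

Lemma Ck_lin U k (l : V -> R) : linear_for *%R l -> continuous l -> Ck U k l.
Proof.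
move=> ll lc; pose L := GRing.isLinear.Build _ _ _ _ l ll.
pose l' : {linear V -> R} := HB.pack l L.
case: k => [|k]; first by move=> x _; exact: lc.
have dl x : differentiable l x by exact: (@linear_differentiable _ _ _ l').
split => // v.
rewrite (_ : 'D_v _ = fun=> l v); first exact: Ck_cst.
by apply/funext => x; rewrite deriveE// (@diff_lin _ _ _ l').
Qed.

Lemma Ck_add U k h g : open U -> Ck U k h -> Ck U k g ->
  Ck U k (fun x => h x + g x).
Proof.
move=> oU; elim: k h g => [|k IH] h g /=.
  by move=> ch cg x Ux; apply: cvgD; [exact: ch|exact: cg].
move=> [dh Dh] [dg Dg]; split=> [x Ux|v].
  exact: differentiableD (dh x Ux) (dg x Ux).
apply: Ck_ext (IH _ _ (Dh v) (Dg v)) => // x Ux.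
by rewrite -deriveD//; apply: diff_derivable; [exact: dh|exact: dg].
Qed.

Lemma Ck_mul U k h g : open U -> Ck U k h -> Ck U k g ->
  Ck U k (fun x => h x * g x).
Proof.
move=> oU; elim: k h g => [|k IH] h g.
  by move=> ch cg x Ux; apply: cvgM; [exact: ch|exact: cg].
move=> hk gk; have [dh Dh] := hk; have [dg Dg] := gk; split=> [x Ux|v].
  exact: differentiableM (dh x Ux) (dg x Ux).
have := Ck_add oU (IH _ _ (Ck_pred hk) (Dg v)) (IH _ _ (Ck_pred gk) (Dh v)).
apply: Ck_ext => // x Ux.
rewrite -[RHS]/('D_v (h * g) x) deriveM//; apply: diff_derivable;
  [exact: dh|exact: dg].
Qed.

Lemma Ck_opp U k h : open U -> Ck U k h -> Ck U k (fun x => - h x).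
Proof.
move=> oU hk; apply: Ck_ext (Ck_mul oU (Ck_cst U k (-1)) hk) => // x _.
by rewrite mulN1r.
Qed.

Lemma Ck_sub U k h g : open U -> Ck U k h -> Ck U k g ->
  Ck U k (fun x => h x - g x).
Proof. by move=> oU hk gk; apply: Ck_add => //; exact: Ck_opp. Qed.

Lemma Ck_sum U k (I : Type) (r : seq I) (h : I -> V -> R) : open U ->
  (forall i, Ck U k (h i)) -> Ck U k (fun x => \sum_(i <- r) h i x).
Proof.
move=> oU hk; elim: r => [|i r IH].
  by apply: Ck_ext (Ck_cst U k 0) => // x _; rewrite big_nil.
by apply: Ck_ext (Ck_add oU (hk i) IH) => // x _; rewrite big_cons.
Qed.

(** By induction on k, since the derivative of 1/h is -h'/h^2 and the induction
    hypothesis applies to 1/h itself. *)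
Lemma Ck_inv U k h : open U -> (forall x, U x -> h x != 0) ->
  Ck U k h -> Ck U k (fun x => (h x)^-1).
Proof.
move=> oU h0; elim: k => [|k IH].
  by move=> ch x Ux; apply: cvgV; [exact: h0|exact: ch].
move=> hk; have [dh Dh] := hk; have ik := IH (Ck_pred hk); split=> [x Ux|v].
  exact: differentiableV (dh x Ux) (h0 x Ux).
have := Ck_opp oU (Ck_mul oU (Ck_mul oU ik ik) (Dh v)).
apply: Ck_ext => // x Ux.
rewrite deriveV ?h0//; last exact/diff_derivable/dh.
by rewrite /GRing.scale/= mulNr -exprVn expr2.
Qed.

End Ck_calculus.

(** * Coordinates and the chain rule *)

(** A finite basis with its continuous dual basis.  The index is a finite type
    rather than an ordinal so that products simply take the sum of the indices,
    and coordinate functions of nested products compute to projections. *)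
Record coords (R : realType) (W : normedModType R) := Coords {
  cidx : finType;
  cvec : cidx -> W;
  cfun : cidx -> W -> R;
  clin : forall i, linear_for *%R (cfun i);
  ccont : forall i, continuous (cfun i);
  cdec : forall w, w = \sum_i cfun i w *: cvec i }.
Arguments cvec {R W} c i : rename.
Arguments cfun {R W} c i w : rename.
Arguments clin {R W} c i : rename.
Arguments ccont {R W} c i : rename.

Definition coords_real (R : realType) : coords R.
Proof.
exists unit (fun=> 1 : R) (fun=> id) => [_ a x y //|_ x|w]; first exact: cvg_id.
by rewrite big_const card_unit/= addr0 /GRing.scale/= mulr1.
Defined.

Lemma pair_l (R : realType) (V W : normedModType R) :
  {morph (fun v : V => (v, 0 : W)) : x y / x + y}.
Proof. by move=> x y; congr pair; rewrite /= addr0. Qed.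

Lemma pair_r (R : realType) (V W : normedModType R) :
  {morph (fun w : W => (0 : V, w)) : x y / x + y}.
Proof. by move=> x y; congr pair; rewrite /= addr0. Qed.

Definition coords_pair (R : realType) (V W : normedModType R)
  (cV : coords V) (cW : coords W) : coords (V * W)%type.
Proof.
exists (cidx cV + cidx cW)%type
  (fun i => match i with inl i => (cvec cV i, 0) | inr j => (0, cvec cW j) end)
  (fun i x => match i with inl i => cfun cV i x.1 | inr j => cfun cW j x.2 end).
- by move=> [i|j] a x y; rewrite clin.
- move=> [i|j] x.
    by apply: (@cvg_comp _ _ _ fst (cfun cV i) _ _ _ cvg_fst); exact: ccont.
  by apply: (@cvg_comp _ _ _ snd (cfun cW j) _ _ _ cvg_snd); exact: ccont.
- move=> [v w]; rewrite big_sumType/= {1}(cdec cV v) {1}(cdec cW w).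
  have E1 : \sum_i cfun cV i v *: (cvec cV i, 0 : W) = (\sum_i cfun cV i v *:
    cvec cV i, 0).
    by rewrite (big_morph _ (@pair_l _ V W) erefl); apply: eq_bigr => i _;
      congr pair; rewrite /= scaler0.
  have E2 : \sum_i cfun cW i w *: (0 : V, cvec cW i) = (0, \sum_i cfun cW i w
    *: cvec cW i).
    by rewrite (big_morph _ (@pair_r _ V W) erefl); apply: eq_bigr => i _;
      congr pair; rewrite /= scaler0.
  by rewrite E1 E2; congr pair; rewrite /= ?addr0 ?add0r.
Defined.

Definition coords2 (R : realType) := coords_pair (coords_real R) (coords_real
  R).
Definition coords4 (R : realType) := coords_pair (coords2 R) (coords2 R).

Lemma Ck_cfun (R : realType) (V : normedModType R) (c : coords V) (U : set V) k
  i :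
  Ck U k (cfun c i).
Proof. by apply: Ck_lin; [exact: clin|exact: ccont]. Qed.

Lemma cfun_bounded (R : realType) (W : normedModType R) (c : coords W) i :
  exists C, 0 < C /\ forall w, `|cfun c i w| <= C * `|w|.
Proof.
pose L := GRing.isLinear.Build _ _ _ _ _ (clin c i).
pose l : {linear W -> R} := HB.pack (cfun c i) L.
have /linear_boundedP[r [_ Hr]] : bounded_near l (nbhs 0).
  by apply/linear_bounded_continuous; exact: ccont.
exists (Num.max (r + 1) 1); split; first by rewrite lt_max ltr01 orbT.
by apply: Hr; rewrite lt_max ltrDl ltr01.
Qed.

(** Up to rewriting the increment, the difference quotient of the restriction to
    a line is that of h in the direction of the line. *)
Lemma is_derive_line (R : realType) (W : normedModType R) (h : W -> R)
    (x v : W) (t : R) : differentiable h (t *: v + x) ->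
  is_derive t 1 (fun t => h (t *: v + x)) ('D_v h (t *: v + x)).
Proof.
move=> dh; have dt : derivable h (t *: v + x) v by exact: diff_derivable.
have E : (fun a : R => a^-1 *: (h ((a *: 1 + t) *: v + x) - h (t *: v + x))) =
    fun a => a^-1 *: (h (a *: v + (t *: v + x)) - h (t *: v + x)).
  apply/funext => a; congr (_ *: (h _ - _)).
  by rewrite (_ : a *: 1 = a) ?scalerDl ?addrA//; exact: mulr1.
by split; rewrite /derivable /derive /= E.
Qed.

Section chain_rule.
Context {R : realType} {V W : normedModType R} (cW : coords W).

Lemma deriveE_coords (h : W -> R) x w : differentiable h x ->
  'D_w h x = \sum_i cfun cW i w * 'D_(cvec cW i) h x.
Proof.
move=> dh; rewrite deriveE// [in LHS](cdec cW w) linear_sum.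
by apply: eq_bigr => i _; rewrite linearZ deriveE.
Qed.

Lemma continuous_coords (g : V -> W) x :
  (forall i, {for x, continuous (fun y => cfun cW i (g y))}) ->
  {for x, continuous g}.
Proof.
move=> cg.
have -> : g = \sum_i (fun y => cfun cW i (g y) *: cvec cW i).
  by apply/funext => y; rewrite fct_sumE -cdec.
elim/big_ind : _ => [|h h' ch ch'|i _].
- exact: cvg_cst.
- exact: continuousD.
- by apply: cvgZr_tmp; exact: cg.
Qed.

Lemma differentiable_coords (g : V -> W) x :
  (forall i, differentiable (fun y => cfun cW i (g y)) x) ->
  differentiable g x.
Proof.
move=> dg.
have -> : g = \sum_i (fun y => cfun cW i (g y) *: cvec cW i).
  by apply/funext => y; rewrite fct_sumE -cdec.
elim/big_ind : _ => [|h h' dh dh'|i _].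
- exact: differentiable_cst.
- exact: differentiableD.
- exact: differentiableZl.
Qed.

Lemma derive_coords (g : V -> W) x v i : differentiable g x ->
  cfun cW i ('D_v g x) = 'D_v (fun y => cfun cW i (g y)) x.
Proof.
move=> dg; pose L := GRing.isLinear.Build _ _ _ _ _ (clin cW i).
pose l : {linear W -> R} := HB.pack (cfun cW i) L.
have dl y : differentiable l y.
  by apply: linear_differentiable; exact: ccont.
rewrite !deriveE//; last exact: (@differentiable_comp _ _ _ _ g l).
have dc : ('d (l \o g) x : V -> R) = 'd l (g x) \o 'd g x by exact: diff_comp.
rewrite -[RHS]/(('d (l \o g) x : V -> R) v) dc /=.
have E : 'd l (g x) = l :> (W -> R) by apply: diff_lin; exact: ccont.
by rewrite -[RHS]/(('d l (g x) : W -> R) ('d g x v)) E.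
Qed.

(** The directional derivative of h o g along v is the sum over i of
    D_v (c_i o g) times (D_(e_i) h) o g: the directions e_i do not depend on the
    point, so the induction hypothesis applies to each D_(e_i) h. *)
Lemma Ck_comp (U : set V) (U' : set W) k (g : V -> W) (h : W -> R) :
  open U -> (forall x, U x -> U' (g x)) ->
  (forall i, Ck U k (fun x => cfun cW i (g x))) -> Ck U' k h ->
  Ck U k (fun x => h (g x)).
Proof.
move=> oU UU'; elim: k h => [|k IH] h gk.
  move=> ch x Ux; apply: (@cvg_comp _ _ _ g h); last exact: ch (UU' _ Ux).
  by apply: continuous_coords => i; exact: gk.
move=> hk; have [dh Dh] := hk.
have dg x : U x -> differentiable g x.
  by move=> Ux; apply: differentiable_coords => i; have [+ _] := gk i; exact.
split=> [x Ux|v].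
  exact: (@differentiable_comp _ _ _ _ g h _ (dg x Ux) (dh _ (UU' _ Ux))).
have : Ck U k (fun x => \sum_i 'D_v (fun y => cfun cW i (g y)) x *
    'D_(cvec cW i) h (g x)).
  apply: Ck_sum => // i; apply: Ck_mul => //; first by have [_] := gk i; exact.
  by apply: (IH ('D_(cvec cW i) h)) => [j|]; [exact/Ck_pred/gk|exact: Dh].
apply: Ck_ext => // x Ux; have dgx := dg x Ux; have dhx := dh _ (UU' _ Ux).
have dc : ('d (h \o g) x : V -> R) = 'd h (g x) \o 'd g x by exact: diff_comp.
rewrite [RHS](@deriveE _ _ _ (h \o g)); last first.
  exact: (@differentiable_comp _ _ _ _ g h _ dgx dhx).
rewrite dc /= -(deriveE v dgx) -deriveE// (deriveE_coords _ dhx).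
by apply: eq_bigr => i _; rewrite derive_coords.
Qed.

End chain_rule.

Lemma Ck_comp_real (R : realType) (V : normedModType R) (g : V -> R) (h : R ->
  R) k :
  Ck setT k g -> Ck setT k h -> Ck setT k (fun x => h (g x)).
Proof.
move=> cg ch; apply: (@Ck_comp _ _ _ (coords_real R) setT setT) => //.
exact: openT.
Qed.

(** * Integrals depending on a parameter *)

(** The tube lemma: continuity at the points of {y0} x K gives estimates in
    neighbourhoods of these points, and finitely many of them cover {y0} x K. *)
Lemma near_uniform_compact (R : realType) (X Y : topologicalType) (K : set X)
    (psi : Y * X -> R) (y0 : Y) (e : R) : compact K -> 0 < e ->
  (forall x, K x -> {for (y0, x), continuous psi}) ->
  \forall y \near y0, forall x, K x -> `|psi (y, x) - psi (y0, x)| < e.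
Proof.
rewrite compact_near_coveringP => cK e0 cpsi.
apply: (cK Y (nbhs y0) (fun y x => `|psi (y, x) - psi (y0, x)| < e)).
move=> x Kx; have e20 : 0 < e / 2 by rewrite divr_gt0.
have /cvgrPdist_lt/(_ _ e20) [[A B]/= [nA nB] AB] := cpsi x Kx.
exists (B, A) => //= -[x' y]/= [Bx Ay].
have H1 := AB (y, x') (conj Ay Bx).
have H2 := AB (y0, x') (conj (nbhs_singleton nA) Bx).
rewrite /= in H1 H2.
rewrite (splitr e) -(subrKA (psi (y0, x))) (le_lt_trans (ler_normD _ _))//.
by rewrite ltrD// distrC.
Qed.

Section parametric_integral.
Context {R : realType}.
Local Notation mu := (@lebesgue_measure R).
Variable M : R.
Hypothesis M0 : 0 <= M.
Let J : set R := [set` `[- M, M]%R].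

Let mJ : measurable J. Proof. exact: measurable_itv. Qed.

Let muJ : mu J = (2 * M)%:E.
Proof.
have -> : mu J = _ := @lebesgue_measure_itv R `[- M, M]%R.
rewrite /= lte_fin; case: ltP => [_|MM].
  by rewrite /= opprK mulr2n mulrDl !mul1r.
have M1 : M <= - M := MM.
have M00 : M = 0 by move: M0 M1; lra.
by rewrite M00 mulr0.
Qed.

Lemma continuous_itv_integrable (f : R -> R) :
  continuous f -> mu.-integrable J (EFin \o f).
Proof.
move=> cf; apply: continuous_compact_integrable; first exact: segment_compact.
exact: continuous_subspaceT.
Qed.

Lemma normr_Rintegral_le (f : R -> R) (e : R) : continuous f ->
  (forall b, J b -> `|f b| <= e) -> `|\int[mu]_(b in J) f b| <= e * (2 * M).
Proof.
move=> cf fe; apply: le_trans (le_normr_Rintegral _ _) _ => //.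
  exact: continuous_itv_integrable.
have -> : e * (2 * M) = \int[mu]_(_ in J) e.
  rewrite Rintegral_cst//; congr (_ * _); apply: (congr1 fine (esym muJ)).
apply: le_Rintegral => //.
  apply: continuous_itv_integrable => x.
  by apply: continuous_comp; [exact: cf|exact: norm_continuous].
by apply: continuous_itv_integrable => x; exact: cst_continuous.
Qed.

Context {V : normedModType R}.

Variable U : set V.
Hypothesis oU : open U.
Let UT : set (V * R) := U `*` setT.

Lemma continuous_slice (psi : V * R -> R) p : U p -> Ck UT 0 psi ->
  continuous (fun b => psi (p, b)).
Proof.
move=> Up cpsi b; apply: (@cvg_comp _ _ _ (fun b : R =>
  (p, b)) psi _ (nbhs (p, b))).
  by apply: (@cvg_pair _ _ _ _ (nbhs p) (nbhs b));
    [exact: cvg_cst|exact: cvg_id].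
exact: cpsi.
Qed.

Lemma continuous_integral (psi : V * R -> R) : Ck UT 0 psi ->
  Ck U 0 (fun p => \int[mu]_(b in J) psi (p, b)).
Proof.
move=> cpsi p Up; apply/cvgrPdist_le => e e0.
have e10 : 0 < e / (2 * M + 1) by rewrite divr_gt0//; move: M0; lra.
near=> p'; have Up' : U p'.
  by near: p'; exact: open_nbhs_nbhs (conj oU Up).
have H : forall b, J b -> `|psi (p', b) - psi (p, b)| < e / (2 * M + 1).
  near: p'; apply: (near_uniform_compact (@segment_compact R (- M) M)) =>
    // b _.
  exact: cpsi.
rewrite -RintegralB//; last 2 first.
  exact/continuous_itv_integrable/continuous_slice.
  exact/continuous_itv_integrable/continuous_slice.
apply: le_trans (@normr_Rintegral_le _ (e / (2 * M + 1)) _ _) _.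
- move=> b; apply: cvgB; exact: continuous_slice.
- by move=> b Jb; rewrite distrC ltW//; exact: H.
- rewrite -mulrA ler_piMr ?(ltW e0)// ler_pdivrMl ?mulr1; move: M0; lra.
Unshelve. all: by end_near. Qed.

Context (cV : coords V).

(** By the mean value theorem on the segment from p to p + v, the increment of
    Phi(., b) differs from its linear part at p by at most a constant times |v|
    times the oscillation of the partial derivatives between p and a point of
    the segment. This oscillation is small uniformly in b, hence so is the
    integrated remainder. *)
Lemma derive_integral (Phi : V * R -> R) p : U p -> Ck UT 1 Phi ->
  let G p := \int[mu]_(b in J) Phi (p, b) in
  differentiable G p /\
  forall v, 'D_v G p = \int[mu]_(b in J) 'D_(v, 0) Phi (p, b).
Proof.
move=> Up [dPhi DPhi] G.
have cPhi : Ck UT 0 Phi by exact: (@Ck_pred _ _ _ 0 _ (conj dPhi DPhi)).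
pose D i := 'D_(cvec cV i, 0 : R) Phi.
have cD i : Ck UT 0 (D i) by exact: DPhi.
(* Finitely many directions e_i account for all v, which makes the estimates
   below uniform in the direction. *)
have DE q b v : U q -> 'D_(v, 0) Phi (q, b) = \sum_i cfun cV i v * D i (q, b).
  move=> Uq; have dq : differentiable Phi (q, b) by exact: dPhi.
  rewrite deriveE// [in LHS](cdec cV v).
  have -> : (\sum_i cfun cV i v *: cvec cV i, 0 : R) =
      \sum_i cfun cV i v *: (cvec cV i, 0 : R).
    rewrite (big_morph _ (@pair_l _ V R) erefl); apply: eq_bigr => i _.
    by congr pair; rewrite /= scaler0.
  by rewrite linear_sum; apply: eq_bigr => i _; rewrite linearZ -deriveE.
pose I i := \int[mu]_(b in J) D i (p, b).
pose dG v := \sum_i cfun cV i v * I i.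
have lG : linear_for *%R dG.
  move=> a x y; rewrite /dG mulr_sumr -big_split/=; apply: eq_bigr => i _.
  by rewrite clin mulrDl mulrA.
pose L := GRing.isLinear.Build _ _ _ _ dG lG.
pose l : {linear V -> R} := HB.pack dG L.
have cG : continuous dG.
  move=> x; rewrite (_ : dG = \sum_i (fun v => cfun cV i v * I i)); last first.
    by apply/funext => v; rewrite fct_sumE.
  elim/big_ind : _ => [|h h' ch ch'|i _].
  - exact: cvg_cst.
  - exact: continuousD.
  - by apply: cvgMr_tmp; exact: ccont.
have cDv v b : {for b, continuous (fun b => 'D_(v, 0) Phi (p, b))}.
  exact: (continuous_slice Up (DPhi (v, 0))).
have intD v : \int[mu]_(b in J) 'D_(v, 0) Phi (p, b) = dG v.
  under eq_Rintegral do rewrite DE//.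
  rewrite /dG; elim: (index_enum _) => [|i r IH].
    under eq_Rintegral do rewrite big_nil.
    by rewrite big_nil Rintegral_cst// mul0r.
  under eq_Rintegral do rewrite big_cons.
  have cDp j : continuous (fun b => cfun cV j v * D j (p, b)).
    by move=> b; apply: cvgM; [exact: cvg_cst|exact: continuous_slice].
  rewrite RintegralD//; last 2 first.
  - exact: continuous_itv_integrable.
  - apply: continuous_itv_integrable => b.
    elim: r {IH} => [|j r IH].
      by under eq_fun do rewrite big_nil; exact: cvg_cst.
    by under eq_fun do rewrite big_cons; apply: cvgD; [exact: cDp|exact: IH].
  rewrite IH big_cons RintegralZl//.
  exact/continuous_itv_integrable/continuous_slice.
have main : G \o shift p = cst (G p) + l +o_ 0 id.
  have /choice[C HC] := @cfun_bounded _ _ cV.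
  apply/eqaddoP => _/posnumP[e].
  pose K := \sum_i C i; have K0 : 0 <= K by apply: sumr_ge0 => i _;
    exact/ltW/(HC i).1.
  have KM : 0 <= K * (2 * M) by apply: mulr_ge0 => //; move: M0; lra.
  pose eta := e%:num / (K * (2 * M) + 1).
  have eta0 : 0 < eta by rewrite divr_gt0//; lra.
  have : \forall p' \near p, U p' /\
      forall i b, J b -> `|D i (p', b) - D i (p, b)| < eta.
    apply: filterI; first exact: open_nbhs_nbhs (conj oU Up).
    apply: filter_forall => i.
    apply: (near_uniform_compact (@segment_compact R (- M) M)) => // b _.
    exact: cD.
  move=> /nbhs_ballP[r /= r0 Hr].
  apply/nbhs_ballP; exists r => //= v; rewrite -ball_normE/= sub0r normrN => vr.
  have seg (t : R) : 0 <= t -> t <= 1 -> ball p r (t *: v + p).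
    move=> t0 t1; rewrite -ball_normE/= opprD addrCA subrr addr0 normrN normrZ.
    by rewrite ger0_norm// (le_lt_trans _ vr)// ler_piMl.
  have Uv : U (v + p) by have [] := Hr _ (seg 1 ler01 (lexx _));
    rewrite scale1r.
  have line b (t : R) : t *: (v, 0 : R) + (p, b) = (t *: v + p, b).
    by congr pair; rewrite /= scaler0 add0r.
  have der (b t : R) : 0 <= t -> t <= 1 -> is_derive t 1
      (fun t => Phi (t *: (v, 0) + (p, b))) ('D_(v, 0) Phi (t *: (v, 0) + (p,
        b))).
    move=> t0 t1; apply: is_derive_line; rewrite line.
    by apply: dPhi; split=> //; have [] := Hr _ (seg t t0 t1).
  have bound (b : R) : J b ->
      `|Phi (v + p, b) - Phi (p, b) - 'D_(v, 0) Phi (p, b)| <= K * `|v| * eta.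
    move=> Jb; have in01 (t : R) : t \in `[0, 1]%R -> 0 <= t /\ t <= 1.
      by rewrite in_itv => /andP.
    have := @MVT_segment R (fun t => Phi (t *: (v, 0) + (p, b)))
      (fun t => 'D_(v, 0) Phi (t *: (v, 0) + (p, b))) 0 1 ler01.
    case=> [t /subset_itv_oo_cc /in01[t0 t1]||c /in01[c0 c1]]; first exact: der.
      by apply: derivable_within_continuous => t /in01[t0 t1];
        have [] := der b t t0 t1.
    rewrite !line scale1r scale0r add0r subr0 mulr1 => ->.
    have [Uc Hc] := Hr _ (seg c c0 c1).
    rewrite !DE// -sumrB -mulrA mulr_suml.
    apply: le_trans (ler_norm_sum _ _ _) _; apply: ler_sum => i _.
    rewrite -mulrBr normrM mulrA ler_pM//; first exact: (HC i).2.
    exact/ltW/Hc.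
  have cP q : U q -> mu.-integrable J (EFin \o (fun b => Phi (q, b))).
    by move=> Uq; exact/continuous_itv_integrable/continuous_slice.
  rewrite !fctE /= -[dG v]intD opprD addrA /G.
  rewrite -RintegralB ?cP// -RintegralB//; last 2 first.
  - apply: continuous_itv_integrable => b.
    by apply: cvgB; exact: continuous_slice.
  - by apply: continuous_itv_integrable => b; exact: cDv.
  apply: le_trans (@normr_Rintegral_le _ (K * `|v| * eta) _ bound) _.
    move=> b; apply: cvgB; last exact: cDv.
    by apply: cvgB; exact: continuous_slice.
  rewrite /eta (_ : _ * (2 * M) = e%:num * `|v| * (K * (2 * M) / (K * (2 * M) +
    1))); last by ring.
  rewrite ler_piMr ?mulr_ge0// ler_pdivrMr; lra.
have dGE : 'd G p = l :> (V -> R) by exact: diff_unique.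
have dG' : differentiable G p.
  by apply/diff_locallyP; rewrite dGE.
by split=> // v; rewrite deriveE// dGE intD.
Qed.

Lemma Ck_integral k (Phi : V * R -> R) : Ck UT k Phi ->
  Ck U k (fun p => \int[mu]_(b in J) Phi (p, b)).
Proof.
elim: k Phi => [|k IH] Phi; first exact: continuous_integral.
move=> hk; have h1 : Ck UT 1 Phi by exact: Ck_le hk.
split=> [p Up|v]; first by have [] := derive_integral Up h1.
apply: Ck_ext (IH _ (hk.2 (v, 0))) => // p Up.
by have [_ ->] := derive_integral Up h1.
Qed.

Lemma Rintegral_segment (f : R -> R) : (forall b, ~ J b -> f b = 0) ->
  \int[mu]_b f b = \int[mu]_(b in J) f b.
Proof.
move=> f0; rewrite [RHS]Rintegral_mkcond; congr (Rintegral _ _ _).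
apply/funext => b; rewrite patchE; case: ifPn => // /negP bJ.
by apply: f0 => Jb; apply: bJ; exact: mem_set.
Qed.

End parametric_integral.

(** * Bounds on integrals and invariance under translation *)
Section integral_bounds.
Context d (T : measurableType d) (R : realType).
Variable mu : {measure set T -> \bar R}.
Local Open Scope ereal_scope.

(** The integral of a nonnegative function is a supremum over the simple
    functions below it, and a larger function has more of them below it.  This
    compares functions of unknown measurability, such as convolutions, with
    measurable ones. *)
Lemma ge0_le_integral_nonmeas (D : set T) (f g : T -> \bar R) :
  (forall x, D x -> 0 <= f x) -> (forall x, D x -> f x <= g x) ->
  \int[mu]_(x in D) f x <= \int[mu]_(x in D) g x.
Proof.
move=> f0 fg; have g0 x : D x -> 0 <= g x.
  by move=> Dx; exact: le_trans (f0 _ Dx) (fg _ Dx).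
rewrite !ge0_integralE//; apply: ereal_sup_le => _ [h hf <-].
exists h => // x; apply: le_trans (hf x) _; rewrite !patchE; case: ifPn => //.
by move=> /set_mem; exact: fg.
Qed.

(** A real-valued integral is by convention the finite part of a difference of
    two integrals in [0, +oo], both of which are below the integral of g. *)
Lemma normr_Rintegral_le_integral (f : T -> R) (g : T -> \bar R) :
  (forall x, `|f x|%:E <= g x) ->
  (`|(\int[mu]_x f x)%R|%R)%:E <= \int[mu]_x g x.
Proof.
move=> fg.
have fp : \int[mu]_x (EFin \o f)^\+ x <= \int[mu]_x g x.
  apply: ge0_le_integral_nonmeas => x _ //.
  by apply: le_trans (fg x);
    rewrite funeposE /= -EFin_max lee_fin ge_max ler_norm /=.
have fn : \int[mu]_x (EFin \o f)^\- x <= \int[mu]_x g x.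
  apply: ge0_le_integral_nonmeas => x _ //; apply: le_trans (fg x).
  by rewrite funenegE /= -EFin_max lee_fin ge_max -normrN ler_norm /=.
have p0 : 0 <= \int[mu]_x (EFin \o f)^\+ x by apply: integral_ge0.
have n0 : 0 <= \int[mu]_x (EFin \o f)^\- x by apply: integral_ge0.
rewrite /Rintegral integralE.
move: (\int[mu]_x (EFin \o f)^\+ x) (\int[mu]_x (EFin \o f)^\- x)
   (\int[mu]_x g x) fp fn p0 n0 => [a| |] [b| |] [c| |] //=.
- by rewrite !lee_fin => ? ? ? ?; rewrite ler_norml; apply/andP; split; lra.
all: by rewrite ?leey.
Qed.

End integral_bounds.

Section translation.
Context {R : realType}.
Local Notation mu := (@lebesgue_measure R).
Local Open Scope ereal_scope.

Lemma lebesgue_measure_shift (c : R) (A : set (measurableTypeR R)) :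
  measurable A ->
  pushforward mu (fun b : measurableTypeR R =>
    (b - c)%R : measurableTypeR R) A = mu A.
Proof.
move=> mA; have mf : measurable_fun setT
    (fun b : measurableTypeR R => (b - c)%R : measurableTypeR R).
  by apply: (@measurable_funB _ _ _ _ id (cst c)).
apply/esym/(@lebesgue_measure_unique R
  (measure_function_pushforward__canonical__measure_function_Measure mu mf)) =>
    //.
move=> _ [[a b] _ <-] /=; rewrite /pushforward.
rewrite (_ : _ @^-1` _ = `](a + c)%R, (b + c)%R]%classic); last first.
  by apply/seteqP; split=> x /=; rewrite !in_itv/= ltrBrDr lerBlDr.
by rewrite !lebesgue_measure_itv/= !lte_fin ltrD2r -!EFinB opprD addrACA subrr
  addr0.
Qed.

Lemma ge0_integral_shift (c : R) (f : R -> \bar R) :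
  measurable_fun [set: R] f -> (forall x, 0 <= f x) ->
  \int[mu]_x f (x - c)%R = \int[mu]_x f x.
Proof.
move=> mf f0; have mphi : measurable_fun setT
    (fun b : measurableTypeR R => (b - c)%R : measurableTypeR R).
  by apply: (@measurable_funB _ _ _ _ id (cst c)).
transitivity (\int[pushforward mu (fun b : measurableTypeR R =>
  (b - c)%R : measurableTypeR R)]_x f x).
  by rewrite (ge0_integral_pushforward mphi).
apply: (@eq_measure_integral _ _ _ _ _
  (measure_function_pushforward__canonical__measure_function_Measure mu mphi)).
by move=> A mA _; exact: lebesgue_measure_shift.
Qed.

Lemma ge0_integral_shift_Gamma0 (c : R) (f : R * R -> \bar R) :
  measurable_fun [set: R * R] f -> (forall x, 0 <= f x) ->
  \int[@leb2 R]_x f ((x.1 - c)%R, x.2) = \int[@leb2 R]_x f x.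
Proof.
move=> mf f0; have F2 := @fubini_tonelli2 _ _ _ _ R mu mu.
transitivity (\int[mu]_a fubini_G mu (fun x : R * R => f ((x.1 - c)%R, x.2)) a).
  apply: F2 => //; apply: measurableT_comp mf _;
    apply: measurable_fun_pair => //.
  by apply: (@measurable_funB _ _ _ _ fst (cst c)).
transitivity (\int[mu]_a fubini_G mu f a); last exact/esym/F2.
apply: eq_integral => a _; rewrite /fubini_G/=.
rewrite (ge0_integral_shift c (f := fun b => f (b, a)))//.
exact: measurableT_comp mf _.
Qed.

(** Convolution in Gamma_0 translates the group variables and keeps the base
    variables, so these are the translations that occur. *)
Lemma ge0_integral_shift_Gamma00 (c1 c2 : R) (f : (R * R) * (R * R) -> \bar R) :
  measurable_fun [set: (R * R) * (R * R)] f -> (forall x, 0 <= f x) ->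
  \int[@leb4 R]_p f (((p.1.1 - c1)%R, p.1.2), ((p.2.1 - c2)%R, p.2.2)) =
  \int[@leb4 R]_p f p.
Proof.
move=> mf f0; have F1 := @fubini_tonelli1 _ _ _ _ R (@leb2 R) (@leb2 R).
have msh (c : R) : measurable_fun [set: R * R] (fun x : R * R =>
  ((x.1 - c)%R, x.2)).
  apply: measurable_fun_pair => //.
  by apply: (@measurable_funB _ _ _ _ fst (cst c)).
transitivity (\int[@leb2 R]_x fubini_F (@leb2 R) (fun p : (R * R) * (R * R) =>
    f (((p.1.1 - c1)%R, p.1.2), ((p.2.1 - c2)%R, p.2.2))) x).
  apply: F1 => //; apply: measurableT_comp mf _;
    apply: measurable_fun_pair => //=.
    exact: (measurableT_comp (msh c1)).
  exact: (measurableT_comp (msh c2)).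
transitivity (\int[@leb2 R]_x fubini_F (@leb2 R) f x); last exact/esym/F1.
transitivity (\int[@leb2 R]_x fubini_F (@leb2 R) f ((x.1 - c1)%R, x.2)).
  apply: eq_integral => x _; rewrite /fubini_F/=.
  rewrite (ge0_integral_shift_Gamma0 c2 (f := fun y =>
    f (((x.1 - c1)%R, x.2), y)))//.
  exact: measurableT_comp mf _.
apply: ge0_integral_shift_Gamma0; first exact: measurable_fun_fubini_tonelli_F.
by move=> x; apply: integral_ge0.
Qed.

End translation.

(** * The norm of a bounded function supported in a box *)
Section cstar_bound.
Context {R : realType}.
Local Open Scope ereal_scope.
Local Notation R4 := ((R * R) * (R * R))%type.

Lemma measurable_Gamma0 : measurable (@Gamma0 R).
Proof.
have -> : @Gamma0 R = setT `*` ~` [set 0%R].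
  by apply/seteqP; split=> [[b a] /eqP a0|[b a] [_ /eqP a0]].
by apply: measurableX => //; apply: measurableC; exact: measurable_set1.
Qed.

Lemma measurable_Gamma00 : measurable (@Gamma00 R).
Proof. by apply: measurableX; exact: measurable_Gamma0. Qed.

Variable B : R.
Hypothesis B0 : (0 < B)%R.
Let box : set (R * R) := [set` `[- B, B]%R] `*` [set` `[- B, B]%R].
Let mbox : measurable box.
Proof. by apply: measurableX; exact: measurable_itv. Qed.

Let box_measure : @leb2 R box = (4 * B ^+ 2)%:E.
Proof.
have BB : (@lebesgue_measure R) [set` `[- B, B]%R] = (2 * B)%:E.
  rewrite lebesgue_measure_itv/= lte_fin.
  by rewrite (_ : - B < B)%R ?opprK ?mulr2n ?mulrDl ?mul1r//; move: B0; lra.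
have : (@leb2 R) box = (2 * B)%:E * (2 * B)%:E.
  rewrite -BB.
  apply: (@product_measure1E _ _ _ _ _ lebesgue_measure lebesgue_measure);
    exact: measurable_itv.
by move=> ->; rewrite -EFinM; congr EFin; ring.
Qed.

(** The integrand of the squared L^2 norm, extended by zero so that Tonelli's
    theorem applies to it on the whole space. *)
Definition L2density (g : R4 -> R[i]) : R4 -> \bar R :=
  (fun p => (normsq (g p) / (p.1.2 ^+ 2 * p.2.2 ^+ 2))%:E) \_ (@Gamma00 R).

Lemma normsq_ge0 (z : R[i]) : (0 <= normsq z)%R.
Proof. by rewrite addr_ge0// sqr_ge0. Qed.

Lemma L2density_ge0 g p : 0 <= L2density g p.
Proof.
rewrite /L2density patchE; case: ifP => // _.
by rewrite lee_fin divr_ge0 ?normsq_ge0// mulr_ge0// sqr_ge0.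
Qed.

Lemma L2sqE g : L2sq g = \int[@leb4 R]_p L2density g p.
Proof. by rewrite /L2sq integral_mkcond. Qed.

Lemma measurable_L2density g :
  L2fun g -> measurable_fun [set: R4] (L2density g).
Proof.
move=> [mr mi _]; apply/(measurable_restrictT _ measurable_Gamma00).
apply/measurable_EFinP; apply: measurable_funM.
  by apply: measurable_funD; exact: measurable_funX.
have -> : (fun p : R4 => (p.1.2 ^+ 2 * p.2.2 ^+ 2)^-1)%R =
    (fun p : R4 => powR (p.1.2 ^+ 2 * p.2.2 ^+ 2) (-1)).
  by apply/funext => p; rewrite powR_inv1// mulr_ge0 ?sqr_ge0.
apply: measurable_funTS;
  apply: (measurableT_comp (f := fun x : R => powR x (-1))
  (g := fun p : R4 => p.1.2 ^+ 2 * p.2.2 ^+ 2)%R); first exact: measurable_powR.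
apply: measurable_funM; apply: measurable_funX.
  exact: measurableT_comp measurable_snd measurable_fst.
exact: measurableT_comp measurable_snd measurable_snd.
Qed.

Variable eta : R.
Hypothesis eta0 : (0 < eta)%R.

Lemma normr_mul_le (z w : R[i]) :
  (`|complex.Re z| <= eta)%R -> (`|complex.Im z| <= eta)%R ->
  (`|complex.Re (z * w)| <= eta * (`|complex.Re w| + `|complex.Im w|))%R /\
  (`|complex.Im (z * w)| <= eta * (`|complex.Re w| + `|complex.Im w|))%R.
Proof.
case: z w => [x y] [u v] /= xe ye; rewrite mulrDr; split.
  by apply: le_trans (ler_normB _ _) _; rewrite lerD// normrM ler_wpM2r.
by rewrite addrC; apply: le_trans (ler_normD _ _) _;
  rewrite lerD// normrM ler_wpM2r.
Qed.

Variables h g : R4 -> R[i].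
Hypothesis he : forall p, @Gamma00 R p ->
  (`|complex.Re (h p)| <= eta)%R /\ (`|complex.Im (h p)| <= eta)%R.
Hypothesis hB : forall p, @Gamma00 R p -> ~ box (p.1.1, p.2.1) -> h p = 0%R.
Hypothesis hg : L2fun g.

(* The function K is measurable jointly in (p, c), which lets the integrals over
   p and over c be exchanged. *)
Let sh (p : R4) (c : R * R) : R4 :=
  (((p.1.1 - c.1)%R, p.1.2), ((p.2.1 - c.2)%R, p.2.2)).
Let K (p : R4) (c : R * R) := (\1_box c)%:E * L2density g (sh p c).

Let measurable_sh : measurable_fun [set: R4 * (R * R)] (fun z => sh z.1 z.2).
Proof.
pose P := (R4 * (R * R))%type.
have m11 : measurable_fun [set: P] (fun z : P => z.1.1).
  exact: measurableT_comp measurable_fst measurable_fst.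
have m12 : measurable_fun [set: P] (fun z : P => z.1.2).
  exact: measurableT_comp measurable_snd measurable_fst.
apply: measurable_fun_pair; apply: measurable_fun_pair.
- apply: (measurable_funB (f := fun z : P => z.1.1.1)
    (g := fun z : P => z.2.1)).
    exact: measurableT_comp measurable_fst m11.
  exact: measurableT_comp measurable_fst measurable_snd.
- exact: measurableT_comp measurable_snd m11.
- apply: (measurable_funB (f := fun z : P => z.1.2.1)
    (g := fun z : P => z.2.2)).
    exact: measurableT_comp measurable_fst m12.
  exact: measurableT_comp measurable_snd measurable_snd.
- exact: measurableT_comp measurable_snd m12.
Qed.

Let measurable_K : measurable_fun [set: R4 * (R * R)] (fun z => K z.1 z.2).
Proof.
apply: emeasurable_funM.
  apply/measurable_EFinP; apply: measurableT_comp measurable_snd.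
  exact: measurable_indic.
exact: (measurableT_comp (measurable_L2density hg) measurable_sh).
Qed.

Let K0 p c : 0 <= K p c.
Proof. by rewrite mule_ge0 ?L2density_ge0// lee_fin. Qed.

Let mKp p : measurable_fun [set: R * R] (K p).
Proof.
apply: (measurableT_comp (f := fun z : R4 * (R * R) => K z.1 z.2)
  (g := fun c => (p, c)) measurable_K).
exact: measurable_fun_pair.
Qed.

(** The Cauchy-Schwarz inequality on the box, in the form obtained by optimizing
    x + y <= (x^2 + y^2) / l + l / 2 over l > 0.  The function f stands for the
    real or the imaginary part of the integrand of conv h g at p. *)
Lemma conv_part_le (p : R4) (f : R * R -> R) : @Gamma00 R p ->
  (forall c, `|f c| <= eta * \1_box c *
     (`|complex.Re (g (sh p c))| + `|complex.Im (g (sh p c))|))%R ->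
  ((\int[@leb2 R]_c f c)%R ^+ 2)%:E <=
  (8 * eta ^+ 2 * B ^+ 2 * (p.1.2 ^+ 2 * p.2.2 ^+ 2))%:E *
    \int[@leb2 R]_c K p c.
Proof.
move=> Gp fle; set A := (p.1.2 ^+ 2 * _)%R; set r := (X in (X ^+ 2)%:E <= _).
have A0 : (0 < A)%R.
  by case: Gp => /= a1 a2; rewrite mulr_gt0// lt_def sqrf_eq0 sqr_ge0 ?a1 ?a2.
have bound (l : R) : (0 < l)%R -> (`|r|)%:E <=
    (eta * A / l)%:E * \int[@leb2 R]_c K p c + (eta * l * (2 * B ^+ 2))%:E.
  move=> l0.
  have cK : 0 <= (eta * A / l)%:E by rewrite lee_fin; apply/ltW/divr_gt0 => //;
    exact: mulr_gt0.
  have cI : 0 <= (eta * l / 2)%:E by rewrite lee_fin; apply/ltW/divr_gt0 => //;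
    exact: mulr_gt0.
  have -> : (eta * A / l)%:E * \int[@leb2 R]_c K p c +
        (eta * l * (2 * B ^+ 2))%:E =
      \int[@leb2 R]_c ((eta * A / l)%:E * K p c +
        (eta * l / 2)%:E * (\1_box c)%:E).
    rewrite ge0_integralD//; last 4 first.
    - by move=> c _; rewrite mule_ge0 ?K0.
    - exact: (measurable_funeM _ (mKp p)).
    - by move=> c _; rewrite mule_ge0 ?lee_fin.
    - by apply: measurable_funeM; apply/measurable_EFinP;
      exact: measurable_indic.
    rewrite ge0_integralZl//; last exact: mKp.
    rewrite ge0_integralZl//; last first.
      by apply/measurable_EFinP; exact: measurable_indic.
    congr (_ + _); transitivity ((eta * l / 2)%:E * (4 * B ^+ 2)%:E).
      by rewrite -EFinM; congr EFin; field.
    by congr (_ * _); rewrite integral_indic// setIT; exact/esym/box_measure.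
  apply: normr_Rintegral_le_integral => c; have := fle c.
  rewrite /K /L2density patchE /sh mem_set; last by case: Gp.
  rewrite -/A -!EFinM -EFinD lee_fin; move=> /le_trans; apply.
  rewrite indicE; case: (c \in box) => /=;
    last by rewrite !(mulr0, mul0r) addr0.
  rewrite !mulr1 mul1r; set z := g _.
  set x := (`|_|)%R; set y := (`|_|)%R.
  have zE : normsq z = (x ^+ 2 + y ^+ 2)%R by rewrite !real_normK ?num_real.
  rewrite zE; apply: (@le_trans _ _ (eta * ((x ^+ 2 + y ^+ 2) / l + l / 2))%R).
    rewrite ler_wpM2l ?(ltW eta0)// -subr_ge0.
    have -> : ((x ^+ 2 + y ^+ 2) / l + l / 2 - (x + y) =
      ((x - l / 2) ^+ 2 + (y - l/2) ^+ 2) / l)%R by field; rewrite gt_eqF.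
    by rewrite divr_ge0 ?addr_ge0 ?sqr_ge0 ?ltW.
  rewrite le_eqVlt; apply/orP; left; apply/eqP; field.
  by rewrite !gt_eqF.
have S0 : 0 <= \int[@leb2 R]_c K p c by apply: integral_ge0.
have C0 : (0 < 8 * eta ^+ 2 * B ^+ 2 * A)%R.
  by clearbody A; rewrite !mulr_gt0 ?exprn_gt0.
move: (\int[@leb2 R]_c K p c) S0 bound => [S| |]// S0 bound; last first.
  by rewrite gt0_muley ?leey ?lte_fin.
rewrite -EFinM lee_fin; have [->|r0] := eqVneq r 0%R.
  by rewrite expr0n/=; apply: mulr_ge0; [exact: ltW|rewrite -lee_fin].
have r0' : (0 < `|r|)%R by rewrite normr_gt0.
(* This l makes the second term of the bound equal to |r| / 2. *)
have l0 : (0 < `|r| / (4 * eta * B ^+ 2))%R by rewrite divr_gt0 ?mulr_gt0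
  ?exprn_gt0.
have := bound _ l0; rewrite -EFinM -EFinD lee_fin => H.
rewrite -[(r ^+ 2)%R]real_normK ?num_real//.
have E : ((eta * A / (`|r| / (4 * eta * B ^+ 2)) * S +
   eta * (`|r| / (4 * eta * B ^+ 2)) * (2 * B ^+ 2)) =
  (4 * eta ^+ 2 * B ^+ 2 * A * S) / `|r| + `|r| / 2)%R.
  by field; rewrite !gt_eqF.
move: H; rewrite E => H.
have : (`|r| / 2 * `|r| <= 4 * eta ^+ 2 * B ^+ 2 * A * S)%R.
  by rewrite -ler_pdivlMr//; move: H; lra.
rewrite expr2; lra.
Qed.

Lemma L2density_conv_le p :
  L2density (Defs.conv h g) p <=
  (16 * eta ^+ 2 * B ^+ 2)%:E * \int[@leb2 R]_c K p c.
Proof.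
rewrite /L2density patchE; case: ifPn => [/set_mem Gp|_]; last first.
  by apply: mule_ge0; [rewrite lee_fin !mulr_ge0 ?sqr_ge0 ?(ltW eta0)
    ?(ltW B0)|exact: integral_ge0].
have A0 : (0 < p.1.2 ^+ 2 * p.2.2 ^+ 2)%R.
  by case: Gp => /= a1 a2; rewrite mulr_gt0// lt_def sqrf_eq0 sqr_ge0 ?a1 ?a2.
have hle c : let f := (h ((c.1, p.1.2), (c.2, p.2.2)) * g (sh p c))%R in
    let bd := (eta * \1_box c *
      (`|complex.Re (g (sh p c))| + `|complex.Im (g (sh p c))|))%R in
    (`|complex.Re f| <= bd)%R /\ (`|complex.Im f| <= bd)%R.
  have Gc : @Gamma00 R ((c.1, p.1.2), (c.2, p.2.2)) by case: Gp.
  rewrite /= indicE; case: (boolP (c \in box)) => cb.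
    by rewrite mulr1; have [] := he Gc; exact: normr_mul_le.
  rewrite hB// ?mul0r ?normr0 ?mulr0 ?mul0r//.
  by move=> bc; move/negP: cb; apply; rewrite inE; case: c bc {Gc}.
have re_le := conv_part_le Gp (fun c => (hle c).1).
have im_le := conv_part_le Gp (fun c => (hle c).2).
have F0 : 0 <= \int[@leb2 R]_c K p c by apply: integral_ge0.
rewrite /normsq mulrC EFinM.
have -> : (16 * eta ^+ 2 * B ^+ 2)%:E * \int[@leb2 R]_c K p c =
   ((p.1.2 ^+ 2 * p.2.2 ^+ 2)^-1)%:E *
   ((8 * eta ^+ 2 * B ^+ 2 * (p.1.2 ^+ 2 * p.2.2 ^+ 2))%:E *
      \int[@leb2 R]_c K p c +
    (8 * eta ^+ 2 * B ^+ 2 * (p.1.2 ^+ 2 * p.2.2 ^+ 2))%:E *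
      \int[@leb2 R]_c K p c).
  have c0 : 0 <= (8 * eta ^+ 2 * B ^+ 2 * (p.1.2 ^+ 2 * p.2.2 ^+ 2))%:E.
    rewrite lee_fin; apply: mulr_ge0; last exact: ltW.
    by rewrite !mulr_ge0 ?(ltW eta0) ?(ltW B0).
  rewrite -ge0_muleDl//.
  rewrite muleA -EFinD -EFinM; congr (_%:E * _).
  by move: A0; set A := (p.1.2 ^+ 2 * _)%R => A0; field; rewrite gt_eqF.
rewrite lee_wpmul2l ?lee_fin ?invr_ge0 ?(ltW A0)// EFinD.
exact: leeD re_le im_le.
Qed.

(** After exchanging the integrals over p and c, the integral over p of the
    translate by c is that of the function itself, and c ranges over a box of
    measure 4 B^2. *)
Lemma conv_L2_le : L2sq (Defs.conv h g) <= (64 * eta ^+ 2 * B ^+ 4)%:E * L2sq g.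
Proof.
pose Kz z := K z.1 z.2.
have c16 : 0 <= (16 * eta ^+ 2 * B ^+ 2)%:E by rewrite lee_fin !mulr_ge0
  ?sqr_ge0 ?(ltW eta0) ?(ltW B0).
rewrite L2sqE.
apply: (@le_trans _ _ (\int[@leb4 R]_p
    ((16 * eta ^+ 2 * B ^+ 2)%:E * fubini_F (@leb2 R) Kz p))).
  apply: ge0_le_integral_nonmeas => p _; first exact: L2density_ge0.
  exact: L2density_conv_le.
rewrite ge0_integralZl//; last 2 first.
- by apply: measurable_fun_fubini_tonelli_F => // z; exact: K0.
- by move=> p _; apply: integral_ge0 => c _; exact: K0.
have -> : \int[@leb4 R]_p fubini_F (@leb2 R) Kz p =
    \int[@leb2 R]_c \int[@leb4 R]_p K p c.
  by apply: (@fubini_tonelli _ _ _ _ R (@leb4 R) (@leb2 R) Kz) => // z;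
    exact: K0.
have inner c : \int[@leb4 R]_p K p c = L2sq g * (\1_box c)%:E.
  rewrite muleC L2sqE -(ge0_integral_shift_Gamma00 c.1 c.2 (f := L2density g));
    last 2 first.
  - exact: measurable_L2density.
  - exact: L2density_ge0.
  rewrite -ge0_integralZl ?lee_fin//.
    apply: (measurableT_comp (f := L2density g) (g := fun p => sh p c)).
      exact: measurable_L2density.
    apply: (measurableT_comp (f := fun z : R4 * (R * R) => sh z.1 z.2)
      (g := fun p => (p, c)) measurable_sh).
    exact: measurable_fun_pair.
  by move=> p _; exact: L2density_ge0.
under eq_integral do rewrite inner.
have L0 : 0 <= L2sq g by rewrite L2sqE; apply: integral_ge0 => p _;
  exact: L2density_ge0.
rewrite ge0_integralZl//; last first.
  by apply/measurable_EFinP; exact: measurable_indic.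
have -> : \int[@leb2 R]_c (\1_box c)%:E = (4 * B ^+ 2)%:E.
  by rewrite integral_indic// setIT; exact: box_measure.
rewrite [L2sq g * _]muleC muleA -EFinM le_eqVlt; apply/orP; left; apply/eqP.
by congr (_%:E * _); ring.
Qed.

End cstar_bound.

Lemma cstar_norm_ge0 (R : realType) h : (0 <= @cstar_norm R h)%E.
Proof. by apply: le_ereal_inf_tmp => _ [C [C0 _] <-]; rewrite lee_fin. Qed.

(** This turns uniform estimates with control of the supports into estimates of
    the C*-norm; only the supports in the group variables matter. *)
Lemma cstar_norm_le (R : realType) (B eta : R) (h : (R * R) * (R * R) -> R[i]) :
  0 < B -> 0 < eta ->
  (forall p, @Gamma00 R p ->
    `|complex.Re (h p)| <= eta /\ `|complex.Im (h p)| <= eta) ->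
  (forall p, @Gamma00 R p -> ~ (`|p.1.1| <= B /\ `|p.2.1| <= B) -> h p = 0) ->
  (cstar_norm h <= (8 * eta * B ^+ 2)%:E)%E.
Proof.
move=> B0 eta0 he hB; apply: ereal_inf_lbound; exists (8 * eta * B ^+ 2) => //.
split=> [|g hg]; first by rewrite !mulr_ge0 ?(ltW eta0) ?(ltW B0).
rewrite (_ : _ ^+ 2 = 64 * eta ^+ 2 * B ^+ 4); last by ring.
apply: conv_L2_le => // p Gp nb; apply: hB => // -[b1 b2]; apply: nb.
by split; rewrite /= in_itv/= -ler_norml.
Qed.

(** * Extension by zero and compact subsets *)
Section extension_by_zero.
Context {R : realType} {V : normedModType R}.
Implicit Types (U K : set V).

(** The values off U of a function representing an element of D(U) are
    arbitrary; here they are replaced by zero. *)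
Definition ext0 U (h : V -> R[i]) (x : V) : R[i] := if x \in U then h x else 0.

Definition smooth (h : V -> R) := forall k, Ck setT k h.

(** The open sets U and ~` K cover the space: on the first the extension is h,
    on the second it is zero. *)
Lemma ext0_smooth U K (h : V -> R[i]) : open U -> compact K -> K `<=` U ->
  vanishes_off U K h -> smooth_on U h ->
  smooth (fun x => complex.Re (ext0 U h x)) /\
  smooth (fun x => complex.Im (ext0 U h x)).
Proof.
move=> oU cK KU hK sh.
have oK : open (~` K) by apply: closed_openC;
  exact: compact_closed (@norm_hausdorff _ V) cK.
have UK : U `|` ~` K = setT.
  apply/seteqP; split=> // x _; by case: (pselect (K x)) => [/KU Ux|nKx];
    [left|right].
have part (P : R[i] -> R) : P 0 = 0 -> (forall k, Ck U k (fun x => P (h x))) ->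
    smooth (fun x => P (ext0 U h x)).
  move=> P0 hU k; rewrite -UK; apply: Ck_union.
    by apply: Ck_ext (hU k) => // x Ux; rewrite /ext0 mem_set.
  apply: Ck_ext (Ck_cst _ k 0) => // x Kx; rewrite /ext0.
  by case: ifPn => // /set_mem Ux; rewrite hK.
by split; apply: part => // k; have [] := sh k.
Qed.

Lemma compact_bounded_away (K : set V) (g : V -> R) : compact K ->
  continuous g -> (forall x, K x -> g x != 0) ->
  exists m, 0 < m /\ forall x, K x -> m <= `|g x|.
Proof.
move=> cK cg g0; have [[x Kx]|K0] := pselect (K !=set0); last first.
  by exists 1; split=> // x Kx; exfalso; apply: K0; exists x.
have [||c /set_mem Kc cmin] := @compact_EVT_min _ _ (fun x => `|g x|) K _ cK.
- by exists x.
- apply: continuous_subspaceT => y.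
  by apply: continuous_comp; [exact: cg|exact: norm_continuous].
exists `|g c|; split; first by rewrite normr_gt0 g0.
by move=> y Ky; apply: cmin; exact: mem_set.
Qed.

Lemma compact_norm_le (K : set V) : compact K ->
  exists M, 1 <= M /\ forall x, K x -> `|x| <= M.
Proof.
move=> /compact_bounded[M [_ HM]]; exists (Num.max (M + 1) 1).
split; first by rewrite le_max lexx orbT.
by apply: HM; rewrite lt_max ltrDl ltr01.
Qed.

End extension_by_zero.

Section annuli.
Context {R : realType}.

(** Every compact subset of Gamma_0 is contained in such a set, for m small and
    B large. *)
Definition annulus (m B : R) : set (R * R) :=
  [set p | `|p.1| <= B /\ m <= `|p.2| <= B].

Definition annulus2 (m B : R) : set ((R * R) * (R * R)) :=
  annulus m B `*` annulus m B.

Lemma annulus_compact m B : compact (annulus m B).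
Proof.
have -> : annulus m B =
    [set` `[- B, B]%R] `*` ([set` `[- B, B]%R] `&` ((@Num.norm _ R) @^-1` [set
      x | m <= x])).
  apply/seteqP; split=> [[b a] /= [b1 /andP[a1 a2]]|[b a] /= [b1 [a1 a2]]].
    by rewrite !in_itv/= -!ler_norml.
  split=> /=; first by move: b1; rewrite in_itv/= -ler_norml.
  by apply/andP; split=> //; move: a1; rewrite in_itv/= -ler_norml.
apply: compact_setX; first exact: segment_compact.
apply: compact_closedI; first exact: segment_compact.
apply: preimage_closed; last exact: closed_ge.
by move=> x _; exact: norm_continuous.
Qed.

Lemma annulus2_compact m B : compact (annulus2 m B).
Proof. by apply: compact_setX; exact: annulus_compact. Qed.

Lemma annulus2_sub m B : 0 < m -> annulus2 m B `<=` @Gamma00 R.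
Proof.
move=> m0 [[b1 a1] [b2 a2]] /= [[_ /andP[/= m1 _]] [_ /andP[/= m2 _]]].
by split; rewrite /Gamma0/= -normr_gt0; exact: lt_le_trans m0 _.
Qed.

Lemma Gamma0_open : open (@Gamma0 R).
Proof.
have -> : @Gamma0 R = snd @^-1` [set a | a != 0].
  by apply/seteqP; split.
apply: open_comp; last exact: open_neq.
by move=> p _; exact: cvg_snd.
Qed.

Lemma Gamma00_open : open (@Gamma00 R).
Proof.
have -> : @Gamma00 R = fst @^-1` (@Gamma0 R) `&` snd @^-1` (@Gamma0 R).
  by apply/seteqP; split.
apply: openI; apply: open_comp; try exact: Gamma0_open.
  by move=> p _; exact: cvg_fst.
by move=> p _; exact: cvg_snd.
Qed.

Lemma compact_in_annulus (K : set (R * R)) : compact K -> K `<=` @Gamma0 R ->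
  exists m M, [/\ 0 < m, m <= 1, 1 <= M & K `<=` annulus m M].
Proof.
move=> cK KG; have [M [M1 HM]] := compact_norm_le cK.
have csnd : continuous (snd : R * R -> R) by move=> p; exact: cvg_snd.
have [m [m0 Hm]] := compact_bounded_away cK csnd KG.
exists (Num.min m 1), M; split=> //.
- by rewrite lt_min m0 ltr01.
- by rewrite ge_min lexx orbT.
move=> [b a] Kp; have := HM _ Kp; rewrite prod_normE/= ge_max => /andP[bM aM].
by split=> //=; rewrite aM andbT ge_min (Hm _ Kp).
Qed.

Lemma annulusS m m' M M' : m' <= m -> M <= M' -> annulus m M `<=` annulus m' M'.
Proof.
move=> mm MM [b a] [/= b1 /andP[a1 a2]]; split=> /=; first exact: le_trans MM.
by rewrite (le_trans mm a1) (le_trans a2 MM).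
Qed.

Lemma annulus2S m m' M M' : m' <= m -> M <= M' ->
  annulus2 m M `<=` annulus2 m' M'.
Proof. by move=> mm MM p [h1 h2]; split; exact: annulusS mm MM _ _. Qed.

Lemma compact_in_annulus2 (K : set ((R * R) * (R * R))) : compact K ->
  K `<=` @Gamma00 R ->
  exists m M, [/\ 0 < m, m <= 1, 1 <= M & K `<=` annulus2 m M].
Proof.
move=> cK KG.
have c1 : compact (fst @` K).
  by apply: continuous_compact cK; apply: continuous_subspaceT => p;
    exact: cvg_fst.
have c2 : compact (snd @` K).
  by apply: continuous_compact cK; apply: continuous_subspaceT => p;
    exact: cvg_snd.
have [|m1 [M1 [m10 m11 M11 H1]]] := compact_in_annulus c1.
  by move=> _ [p Kp <-]; have [] := KG _ Kp.
have [|m2 [M2 [m20 m21 M21 H2]]] := compact_in_annulus c2.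
  by move=> _ [p Kp <-]; have [] := KG _ Kp.
exists (Num.min m1 m2), (Num.max M1 M2); split.
- by rewrite lt_min m10.
- by rewrite ge_min m11.
- by rewrite le_max M11.
move=> p Kp; split.
  apply: (@annulusS m1 _ M1); [by rewrite ge_min lexx|by rewrite le_max lexx|].
  by apply: H1; exists p.
apply: (@annulusS m2 _ M2);
  [by rewrite ge_min lexx orbT|by rewrite le_max lexx orbT|].
by apply: H2; exists p.
Qed.

End annuli.

(** * The support of the integrand *)

(** The bound on s is chosen so that s b and s b1 are small compared with m,
    both for |b| <= M and for |b1| up to 5 M / m, the size of b1 in the support
    of the result. *)
Lemma small_shift_le (R : realType) (m M s : R) : 0 < m -> 1 <= M ->
  `|s| <= m ^+ 2 / (64 * M) -> `|s| * M <= m / 64 * m.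
Proof.
move=> m0 M1 s_small; have M0 : 0 < M by exact: lt_le_trans M1.
apply: le_trans (ler_wpM2r (ltW M0) s_small) _.
by rewrite le_eqVlt; apply/orP; left; apply/eqP; field; rewrite gt_eqF.
Qed.

Lemma small_mul_le (R : realType) (m M s b : R) :
  0 < m -> m <= 1 -> 1 <= M -> `|s| <= m ^+ 2 / (64 * M) -> `|b| <= M ->
  `|s * b| <= m / 64.
Proof.
move=> m0 m1 M1 s_small bM; rewrite normrM (@le_trans _ _ (`|s| * M))//.
  by rewrite ler_wpM2l.
rewrite (le_trans (small_shift_le m0 M1 s_small))// ler_piMr// divr_ge0//.
exact: ltW.
Qed.

(** The singularities of the integrand stay away from the set where it can be
    nonzero. *)
Lemma delta_denom (R : realType) (m M s b b1 a1 : R) :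
  0 < m -> m <= 1 -> 1 <= M -> `|s| <= m ^+ 2 / (64 * M) ->
  `|b| <= M -> `|b1| <= 5 * (M / m) -> m / 2 <= `|a1| ->
  0 < 1 + s * b /\ a1 - s * b1 + s * b != 0.
Proof.
move=> m0 m1 M1 s_small bM b1M a1m.
have sM := small_shift_le m0 M1 s_small.
have sb := small_mul_le m0 m1 M1 s_small bM.
have sb1 : `|s * b1| <= 5 * (m / 64).
  rewrite normrM (le_trans (ler_wpM2l (normr_ge0 _) b1M))//.
  by rewrite mulrCA ler_pM2l// mulrA ler_pdivrMr.
split; first by move: sb; rewrite ler_norml => /andP[]; lra.
rewrite -normr_gt0.
have := ler_normD (a1 - s * b1) (s * b1); rewrite subrK.
have := ler_normB (a1 - s * b1 + s * b) (s * b); rewrite addrK.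
lra.
Qed.

(** With e = 1 + s b, u = a1 - s b1, v = u + s b, and (y1, z1), (y2, z2) the
    two arguments of F, one has a1 = e z1, b1 = b + e y1, a2 = z2 v / u and b2
    = (b + y2 v) / u. As e is close to 1, u is close to a1 and v / u is close
    to 1, bounds on the arguments of F become bounds on (b1, a1, b2, a2). *)
Lemma delta_args_bounds (R : realType) (m M s b b1 a1 b2 a2 : R) :
  0 < m -> m <= 1 -> 1 <= M -> `|s| <= m ^+ 2 / (64 * M) ->
  1 + s * b != 0 -> a1 - s * b1 + s * b != 0 -> `|b| <= M ->
  annulus m M ((b1 - b) / (1 + s * b), a1 / (1 + s * b)) ->
  annulus m M ((- b + b2 * (a1 - s * b1)) / (a1 - s * b1 + s * b),
     a2 * (a1 - s * b1) / (a1 - s * b1 + s * b)) ->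
  annulus2 (m / 2) (5 * (M / m)) ((b1, a1), (b2, a2)).
Proof.
move=> h0 h1 h2 s_small e0 v0 bM [/= y1 /andP[y2 y3]] [/= y4 /andP[y5 y6]].
move: e0 v0 y1 y2 y3 y4 y5 y6.
set e := 1 + s * b; set u := a1 - s * b1; set v := u + s * b.
move=> e0 v0 y1 y2 y3 y4 y5 y6.
have M0 : 0 < M by exact: lt_le_trans h2.
have sM := small_shift_le h0 h2 s_small.
have sb := small_mul_le h0 h1 h2 s_small bM.
have sb' := sb; move: sb'; rewrite ler_norml => /andP[sb1 sb2].
have e_gt : 63 / 64 <= e by rewrite /e; clear - sb1 h1; lra.
have e_lt : e <= 65 / 64 by rewrite /e; clear - sb2 h1; lra.
have ee : `|e| = e by rewrite ger0_norm//; clear - e_gt; lra.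
have q0 : 0 < M / m by rewrite divr_gt0.
have qm : M / m * m = M by rewrite divfK// gt_eqF.
have qM : M <= M / m by rewrite ler_pdivlMr// ler_piMr ?(ltW M0).
have ne : 0 < `|e| by rewrite normr_gt0.
have nv : 0 < `|v| by rewrite normr_gt0.
move: y1 y2 y3 y4 y5 y6; rewrite !normrM !normrV ?unitfE// !ler_pdivrMr//.
rewrite !ler_pdivlMr// ee => y1 y2 y3 y4 y5 y6.
have b1M : `|b1| <= 3 * M.
  have k1 : `|b1| <= `|b1 - b| + `|b|.
    by rewrite (le_trans _ (ler_normD _ _))// subrK.
  have k2 : M * e <= M * (65 / 64) by rewrite ler_pM2l.
  by clear - k1 k2 y1 bM h2; lra.
have a1m : m * (63 / 64) <= `|a1| by rewrite (le_trans _ y2)// ler_pM2l.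
have a1M : `|a1| <= 2 * M.
  by rewrite (le_trans y3)// mulrC ler_pM2r//; clear - e_lt; lra.
have sb1' : `|s * b1| <= 3 * (m / 64).
  rewrite normrM (le_trans (ler_wpM2l (normr_ge0 _) b1M))//.
  rewrite mulrCA ler_pM2l// (le_trans sM)// ler_piMr// divr_ge0//.
  exact: ltW.
have um : m * (60 / 64) <= `|u|.
  have k1 : `|a1| <= `|u| + `|s * b1|.
    by rewrite (le_trans _ (ler_normD _ _))// /u subrK.
  by clear - k1 a1m sb1'; lra.
have nu : 0 < `|u| by rewrite (lt_le_trans _ um)// mulr_gt0.
have vu : `|v| <= 2 * `|u|.
  have k1 : `|v| <= `|u| + `|s * b| by exact: ler_normD.
  by clear - k1 sb um h0; lra.
have uv : `|u| / 2 <= `|v|.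
  have k1 : `|u| <= `|v| + `|s * b|.
    by rewrite (le_trans _ (ler_normB _ _))// /v addrK.
  by clear - k1 sb um h0; lra.
have Mu : M * `|u| <= M / m * `|u| by rewrite ler_pM2r.
have Mv : M * `|v| <= M * (2 * `|u|) by rewrite ler_pM2l.
have qu0 : 0 < M / m * `|u| by rewrite mulr_gt0.
split; split=> /=.
- by clear - b1M qM h2; lra.
- by apply/andP; split; [clear - a1m h0; lra|clear - a1M qM h2; lra].
- rewrite -(ler_pM2r nu) -normrM.
  have k1 : `|b2 * u| <= M * `|v| + `|b|.
    rewrite -[b2 * u](subrK b) (le_trans (ler_normD _ _))// lerD2r.
    by rewrite addrC.
  have k2 : M / m * (m * (60 / 64)) <= M / m * `|u| by rewrite ler_pM2l.
  move: k2; rewrite [_ * (m * _)]mulrA qm => k2.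
  by clear - k1 k2 bM Mu Mv qu0; lra.
- apply/andP; split; rewrite -(ler_pM2r nu).
    have k1 : m * (`|u| / 2) <= m * `|v| by rewrite ler_pM2l.
    by clear - k1 y5; lra.
  by clear - Mu Mv qu0 y6; lra.
Qed.

(** * Joint smoothness of the integrand in all variables *)
Section kernel.
Context {R : realType}.
Local Notation R4 := ((R * R) * (R * R))%type.
Local Notation P := ((R * R4) * R)%type.

(** The integrand of delta_hat for real-valued f and F defined everywhere, with
    s as a variable.  The membership conditions of delta_integrand are absorbed
    by the vanishing of f and F. *)
Definition delta_kernel (f : R * R -> R) (F : R4 -> R) (z : P) : R :=
  let s := z.1.1 in let p := z.1.2 in let b := z.2 in
  let e := 1 + s * b in let u := p.1.2 - s * p.1.1 in let v := u + s * b in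
  if (e != 0) && (v != 0) then
    `|e|^-1 * f (b, s * b + u * (p.2.2 - s * p.2.1)) *
    F (((p.1.1 - b) / e, p.1.2 / e), ((- b + p.2.1 * u) / v, p.2.2 * u / v))
  else 0.

Variables (m M : R) (f : R * R -> R) (F : R4 -> R).
Hypothesis m0 : 0 < m.
Hypothesis m1 : m <= 1.
Hypothesis M1 : 1 <= M.
Hypothesis f0 : forall x, ~ annulus m M x -> f x = 0.
Hypothesis F0 : forall y, ~ annulus2 m M y -> F y = 0.

Let eps := m ^+ 2 / (64 * M).

Lemma delta_kernel_support s p b : `|s| <= eps ->
  ~ (`|b| <= M /\ annulus2 (m / 2) (5 * (M / m)) p) -> delta_kernel f F ((s,
    p), b) = 0.
Proof.
move=> se nbp; rewrite /delta_kernel; case: ifPn => //= /andP[e0 v0].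
set x := (b, _); set y := ((_, _), _).
have [bM|bM] := leP `|b| M; last first.
  by rewrite f0 ?mulr0 ?mul0r// => -[/=]; rewrite leNgt bM.
have [yA|yA] := pselect (annulus2 m M y); last by rewrite F0 ?mulr0.
exfalso; apply: nbp; split=> //;
  case: p e0 v0 @x @y yA => -[b1 a1] [b2 a2] /= e0 v0 [yA1 yA2].
exact: (delta_args_bounds m0 m1 M1 se e0 v0 bM yA1 yA2).
Qed.

Let cP : coords P := coords_pair (coords_pair (coords_real R) (coords4 R))
  (coords_real R).

(** Where e > 0 and v is nonzero the kernel is a composition of smooth
    functions; off the closed set Z that contains its support it is zero; and
    these two open sets cover the region |s| < eps. *)
Lemma Ck_delta_kernel k : smooth f -> smooth F ->
  Ck ([set sp : R * R4 | `|sp.1| < eps] `*` setT) k (delta_kernel f F).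
Proof.
move=> sf sF.
have Xs U j : Ck U j (fun z : P =>
  z.1.1) by exact: (@Ck_cfun _ _ cP U j (inl (inl tt))).
have Xb1 U j : Ck U j (fun z : P => z.1.2.1.1).
  exact: (@Ck_cfun _ _ cP U j (inl (inr (inl (inl tt))))).
have Xa1 U j : Ck U j (fun z : P => z.1.2.1.2).
  exact: (@Ck_cfun _ _ cP U j (inl (inr (inl (inr tt))))).
have Xb2 U j : Ck U j (fun z : P => z.1.2.2.1).
  exact: (@Ck_cfun _ _ cP U j (inl (inr (inr (inl tt))))).
have Xa2 U j : Ck U j (fun z : P => z.1.2.2.2).
  exact: (@Ck_cfun _ _ cP U j (inl (inr (inr (inr tt))))).
have Xb U j : Ck U j (fun z : P =>
  z.2) by exact: (@Ck_cfun _ _ cP U j (inr tt)).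
pose e (z : P) := 1 + z.1.1 * z.2.
pose u (z : P) := z.1.2.1.2 - z.1.1 * z.1.2.1.1.
pose v (z : P) := u z + z.1.1 * z.2.
have Xe U j : open U -> Ck U j e.
  by move=> oU; apply: Ck_add => //; [exact: Ck_cst|exact: Ck_mul].
have Xu U j : open U -> Ck U j u.
  by move=> oU; apply: Ck_sub => //; exact: Ck_mul.
have Xv U j : open U -> Ck U j v.
  by move=> oU; apply: Ck_add => //; [exact: Xu|exact: Ck_mul].
pose O1 := [set z | 0 < e z] `&` [set z | v z != 0].
have oO1 : open O1.
  apply: openI.
    apply: (@open_comp _ _ e [set x | 0 < x]); last exact: open_gt.
    by move=> z _; exact: (Xe setT 0%N openT z I).
  apply: (@open_comp _ _ v [set x | x != 0]); last exact: open_neq.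
  by move=> z _; exact: (Xv setT 0%N openT z I).
pose Z := [set z : P | `|z.2| <= M /\ annulus2 (m / 2) (5 * (M / m)) z.1.2].
have cZ : closed Z.
  have -> : Z = snd @^-1` [set x | `|x| <= M] `&`
     (fun z : P => z.1.2) @^-1` (annulus2 (m / 2) (5 * (M / m))) by [].
  apply: closedI; apply: preimage_closed.
  - by move=> z _; exact: cvg_snd.
  - have -> : [set x : R | `|x| <= M] = (@Num.norm _ R) @^-1` [set x | x <= M]
    by [].
    apply: preimage_closed; last exact: closed_le.
    by move=> z _; exact: norm_continuous.
  - move=> z _; apply: (@cvg_comp _ _ _ (fst : P -> R * R4) snd (nbhs z) (nbhs
    z.1) (nbhs z.1.2)); last exact: cvg_snd.
    exact: cvg_fst.
  - apply: compact_closed; first exact: norm_hausdorff.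
    exact: annulus2_compact.
pose O2 := [set z : P | `|z.1.1| < eps] `&` ~` Z.
have oO2 : open O2.
  apply: openI; last exact: closed_openC.
  apply: (@open_comp _ _ (fun z : P => `|z.1.1|) [set x | x < eps]);
    last exact: open_lt.
  move=> z _; apply: (@cvg_comp _ _ _ (fun z : P => z.1.1) (@Num.norm _ R)).
    exact: (Xs setT 0%N z I).
  exact: norm_continuous.
apply: (@Ck_subset _ _ (O1 `|` O2)).
  move=> [[s [[b1 a1] [b2 a2]]] b] /= [sp _].
  have [Zz|Zz] := pselect (Z ((s, ((b1, a1), (b2, a2))), b)); last by right.
  left; have [bM [[/= b1M /andP[a1m _]] _]] := Zz.
  exact: (delta_denom m0 m1 M1 (ltW sp) bM b1M a1m).
apply: Ck_union; last first.
  apply: Ck_ext (Ck_cst _ k 0) => // -[[s p] b] [/= sp nZ].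
  by rewrite delta_kernel_support// ltW.
have Xei : Ck O1 k (fun z => (e z)^-1).
  by apply: Ck_inv => // [z [ez _]|]; [rewrite gt_eqF|exact: Xe].
have Xvi : Ck O1 k (fun z => (v z)^-1).
  by apply: Ck_inv => // [z []|] //; exact: Xv.
pose X (z : P) := (z.2, z.1.1 * z.2 + u z * (z.1.2.2.2 - z.1.1 * z.1.2.2.1)).
pose Y (z : P) := (((z.1.2.1.1 - z.2) * (e z)^-1, z.1.2.1.2 * (e z)^-1),
  ((- z.2 + z.1.2.2.1 * u z) * (v z)^-1, z.1.2.2.2 * u z * (v z)^-1)).
have XX : Ck O1 k (fun z => f (X z)).
  apply: (@Ck_comp _ _ _ (coords2 R) O1 setT k X f) => //.
  move=> [[]|[]] /=; first exact: Xb.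
  apply: Ck_add => //; first exact: Ck_mul.
  apply: Ck_mul => //; first exact: Xu.
  by apply: Ck_sub => //; exact: Ck_mul.
have XY : Ck O1 k (fun z => F (Y z)).
  apply: (@Ck_comp _ _ _ (coords4 R) O1 setT k Y F) => //.
  move=> [[[]|[]]|[[]|[]]] /=.
  - by apply: Ck_mul => //; exact: Ck_sub.
  - exact: Ck_mul.
  - apply: Ck_mul => //; apply: Ck_add => //; first exact: Ck_opp.
    by apply: Ck_mul => //; exact: Xu.
  - by apply: Ck_mul => //; apply: Ck_mul => //; exact: Xu.
apply: Ck_ext (Ck_mul oO1 (Ck_mul oO1 Xei XX) XY) => // z [/= ez vz].
by rewrite /delta_kernel -/(e z) -/(u z) -/(v z) (gt_eqF ez) vz/= gtr0_norm.
Qed.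

End kernel.

(** * The functions delta_hat as a smooth family *)
Section delta.
Context {R : realType}.
Local Notation R4 := ((R * R) * (R * R))%type.

Variables (f : R * R -> R[i]) (F : R4 -> R[i]).
Let fe := ext0 (@Gamma0 R) f.
Let Fe := ext0 (@Gamma00 R) F.
Let rf x := complex.Re (fe x).
Let jf x := complex.Im (fe x).
Let rF x := complex.Re (Fe x).
Let jF x := complex.Im (Fe x).

Lemma delta_integrandE s p b :
  complex.Re (delta_integrand s f F p b) =
    delta_kernel rf rF ((s, p), b) - delta_kernel jf jF ((s, p), b) /\
  complex.Im (delta_integrand s f F p b) =
    delta_kernel rf jF ((s, p), b) + delta_kernel jf rF ((s, p), b).
Proof.
rewrite /delta_integrand /delta_kernel /rf /jf /rF /jF /fe /Fe /ext0 /=.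
set e := 1 + s * b; set v := _ - _ + s * b.
set x := (b, _); set y1 := (_ / e, _); set y2 := (_ / v, _).
case: (e != 0) => /=; last by rewrite subr0 addr0.
case: (v != 0) => /=; last by rewrite subr0 addr0.
have -> : ((y1, y2) \in @Gamma00 R) = (y1 \in @Gamma0 R) && (y2 \in @Gamma0 R).
  by rewrite in_setX.
case: (x \in _) => /=; last by rewrite !(mulr0, mul0r) subr0 addr0.
case: (y1 \in _) => /=; last by rewrite !(mulr0, mul0r) subr0 addr0.
case: (y2 \in _) => /=; last by rewrite !(mulr0, mul0r) subr0 addr0.
case: (f x) (F (y1, y2)) => [a c] [a' c'] /=.
by rewrite !mul0r subr0 addr0; split; ring.
Qed.

Variables (m M : R).
Hypothesis m0 : 0 < m.
Hypothesis m1 : m <= 1.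
Hypothesis M1 : 1 <= M.
Hypothesis f0 : forall x, ~ annulus m M x -> fe x = 0.
Hypothesis F0 : forall y, ~ annulus2 m M y -> Fe y = 0.
Hypothesis sf : smooth rf /\ smooth jf.
Hypothesis sF : smooth rF /\ smooth jF.

Let eps := m ^+ 2 / (64 * M).
Let eps0 : 0 < eps.
Proof. by rewrite divr_gt0 ?exprn_gt0 ?mulr_gt0 ?(lt_le_trans ltr01 M1). Qed.
Let K : set R4 := annulus2 (m / 2) (5 * (M / m)).
Let J : set R := [set` `[- M, M]%R].
Let W : set (R * R4) := [set sp | `|sp.1| < eps].

Let rf0 x : ~ annulus m M x -> rf x = 0. Proof. by move=> /f0;
  rewrite /rf => ->. Qed.
Let jf0 x : ~ annulus m M x -> jf x = 0. Proof. by move=> /f0;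
  rewrite /jf => ->. Qed.
Let rF0 x : ~ annulus2 m M x -> rF x = 0. Proof. by move=> /F0;
  rewrite /rF => ->. Qed.
Let jF0 x : ~ annulus2 m M x -> jF x = 0. Proof. by move=> /F0;
  rewrite /jF => ->. Qed.

Lemma delta_integrand_support s p b : `|s| <= eps -> ~ (`|b| <= M /\ K p) ->
  complex.Re (delta_integrand s f F p b) = 0 /\
  complex.Im (delta_integrand s f F p b) = 0.
Proof.
move=> se nbp; have [-> ->] := delta_integrandE s p b.
by rewrite !(delta_kernel_support m0 m1 M1 _ _ se nbp)// subr0 addr0.
Qed.

Lemma delta_hat_support s p : `|s| <= eps -> ~ K p -> delta_hat s f F p = 0.
Proof.
move=> se nKp; rewrite /delta_hat /Cintegral.
have z b := delta_integrand_support se (fun bK : `|b| <= M /\ K p => nKp bK.2).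
congr (_ +i* _)%C.
  under eq_Rintegral => b _ do rewrite (z b).1.
  by rewrite Rintegral_cst// mul0r.
under eq_Rintegral => b _ do rewrite (z b).2.
by rewrite Rintegral_cst// mul0r.
Qed.

Let reI (z : (R * R4) * R) := delta_kernel rf rF z - delta_kernel jf jF z.
Let imI (z : (R * R4) * R) := delta_kernel rf jF z + delta_kernel jf rF z.
Definition re_delta_hat (sp : R * R4) : R := \int[@lebesgue_measure R]_(b in J)
  reI (sp, b).
Definition im_delta_hat (sp : R * R4) : R := \int[@lebesgue_measure R]_(b in J)
  imI (sp, b).

Let oW : open W.
Proof.
apply: (@open_comp _ _ (fun z : R * R4 => `|z.1|) [set x | x < eps]);
  last exact: open_lt.
move=> z _; apply: (@cvg_comp _ _ _ (fun z : R * R4 =>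
  z.1) (@Num.norm _ R) (nbhs z) (nbhs z.1)).
  exact: cvg_fst.
exact: norm_continuous.
Qed.

Let oWT : open (W `*` [set: R]).
Proof.
have -> : W `*` [set: R] = fst @^-1` W by apply/seteqP; split=> [? []|].
by apply: open_comp oW => z _; exact: cvg_fst.
Qed.

Let c5 : coords (R * R4)%type := coords_pair (coords_real R) (coords4 R).

Lemma Ck_re_delta_hat k : Ck W k re_delta_hat.
Proof.
apply: (@Ck_integral _ M _ _ W oW c5 k reI); first exact: le_trans ler01 M1.
by apply: Ck_sub => //; apply: Ck_delta_kernel => //;
  (exact: sf.1 || exact: sf.2 || exact: sF.1 || exact: sF.2).
Qed.

Lemma Ck_im_delta_hat k : Ck W k im_delta_hat.
Proof.
apply: (@Ck_integral _ M _ _ W oW c5 k imI); first exact: le_trans ler01 M1.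
by apply: Ck_add => //; apply: Ck_delta_kernel => //;
  (exact: sf.1 || exact: sf.2 || exact: sF.1 || exact: sF.2).
Qed.

(** The integral over the line reduces to one over a segment that depends
    neither on s nor on p. *)
Lemma delta_hatE s p : `|s| <= eps ->
  complex.Re (delta_hat s f F p) = re_delta_hat (s, p) /\
  complex.Im (delta_hat s f F p) = im_delta_hat (s, p).
Proof.
move=> se; have out b : ~ J b -> ~ (`|b| <= M /\ K p).
  by move=> nJ [bM _]; apply: nJ; rewrite /J/= in_itv/= -ler_norml.
split; rewrite /= (@Rintegral_segment _ M).
- by apply: eq_Rintegral => b _; have [] := delta_integrandE s p b.
- by move=> b /out nb; have [] := delta_integrand_support se nb.
- by apply: eq_Rintegral => b _; have [] := delta_integrandE s p b.
- by move=> b /out nb; have [] := delta_integrand_support se nb.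
Qed.

Lemma delta_hat_smooth s : `|s| < eps -> smooth_on (@Gamma00 R) (delta_hat s f
  F).
Proof.
move=> se k; have slice (H : R * R4 -> R) : Ck W k H ->
    Ck (@Gamma00 R) k (fun p => H (s, p)).
  move=> cH; apply: (@Ck_comp _ _ _ c5 _ W k (fun p => (s, p)) H) => //.
    exact: Gamma00_open.
  move=> [[]|i]; first exact: Ck_cst.
  exact: (@Ck_cfun _ _ (coords4 R) _ k i).
split.
  apply: Ck_ext (slice _ (Ck_re_delta_hat k)) => [|p _];
    first exact: Gamma00_open.
  by rewrite (delta_hatE p (ltW se)).1.
apply: Ck_ext (slice _ (Ck_im_delta_hat k)) => [|p _];
  first exact: Gamma00_open.
by rewrite (delta_hatE p (ltW se)).2.
Qed.

Lemma delta_hat_uniform eta : 0 < eta ->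
  \forall s \near (0 : R), `|s| <= eps /\ forall p,
    `|complex.Re (delta_hat s f F p - delta_hat 0 f F p)| <= eta /\
    `|complex.Im (delta_hat s f F p - delta_hat 0 f F p)| <= eta.
Proof.
move=> eta0; have cK : compact K by exact: annulus2_compact.
have at0 (H : R * R4 -> R) : Ck W 0 H -> forall p, K p -> {for (0, p),
  continuous H}.
  by move=> cH p _; apply: cH; rewrite /W/= normr0.
have near_re := near_uniform_compact cK eta0 (at0 _ (Ck_re_delta_hat 0)).
have near_im := near_uniform_compact cK eta0 (at0 _ (Ck_im_delta_hat 0)).
have near_eps : \forall s \near (0 : R), `|s| <= eps.
  exact: (@pseudometric_normed_Zmodule.nbhs0_le R R).
near=> s; have se : `|s| <= eps by near: s.
have e0 : `|0 : R| <= eps by rewrite normr0 ltW.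
split=> // p; have [Kp|nKp] := pselect (K p); last first.
  by rewrite !delta_hat_support// subrr normr0 ltW.
have hr : `|re_delta_hat (s, p) - re_delta_hat (0, p)| < eta by move: p Kp;
  near: s.
have hi : `|im_delta_hat (s, p) - im_delta_hat (0, p)| < eta by move: p Kp
  {hr}; near: s.
have [r1 i1] := delta_hatE p se; have [r2 i2] := delta_hatE p e0.
move: hr hi; rewrite -r1 -r2 -i1 -i2.
case: (delta_hat s f F p) (delta_hat 0 f F p) => [a b] [c d] /=.
by move=> /ltW ? /ltW ?.
Unshelve. all: by end_near. Qed.

End delta.

(** * A smooth partition of unity on the line *)
Section smooth_step.
Context {R : realType}.
Implicit Types (n k : nat) (t x : R).

(** The derivatives of exp(-1/t) are linear combinations of these functions,
    which are flat at 0 to all orders. *)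
Definition flat n t : R := if 0 < t then t^-1 ^+ n * expR (- t^-1) else 0.

(** With y = 1/t and c = n + 2 this is y^n exp(-y) <= c^c y^(-2), that is
    (y / c)^c <= exp(y), which follows from y / c <= exp(y / c). *)
Lemma flat_le n t : `|flat n t| <= n.+2%:R ^+ n.+2 * t ^+ 2.
Proof.
rewrite /flat; case: ltP => [t0|_];
  last by rewrite normr0 mulr_ge0 ?sqr_ge0 ?exprn_ge0 ?ler0n.
have y0 : 0 < t^-1 by rewrite invr_gt0.
rewrite ger0_norm; last first.
  by apply: mulr_ge0; [exact/exprn_ge0/ltW|exact: expR_ge0].
set c : R := n.+2%:R; have c0 : 0 < c by rewrite ltr0n.
have H : (t^-1 / c) ^+ n.+2 <= expR (t^-1).
  have -> : expR (t^-1) = expR (t^-1 / c) ^+ n.+2.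
    by rewrite -expRM_natl -/c mulrCA mulfV ?mulr1 ?gt_eqF.
  apply: lerXn2r; rewrite ?nnegrE ?expR_ge0//; first by rewrite divr_ge0 ?ltW.
  by apply: le_trans (expR_ge1Dx _); rewrite lerDr.
rewrite expRN ler_pdivrMr ?expR_gt0//.
have -> : t^-1 ^+ n = c ^+ n.+2 * t ^+ 2 * (t^-1 / c) ^+ n.+2.
  rewrite expr_div_n [X in _ = _ * (X / _)](_ : _ = t^-1 ^+ n * t^-1 ^+ 2);
    last first.
    by rewrite -exprD addn2.
  rewrite [t^-1 ^+ 2]exprVn; field; rewrite !gt_eqF//= ?exprn_gt0//.
by rewrite ler_wpM2l// mulr_ge0 ?sqr_ge0 ?exprn_ge0 ?ltW.
Qed.

Lemma is_derive_flat n t :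
  is_derive t 1 (flat n) (flat n.+2 t - n%:R * flat n.+1 t).
Proof.
have [t0|t0|->] := ltgtP t 0.
- have -> : flat n.+2 t - n%:R * flat n.+1 t = 0.
    by rewrite /flat ltNge ltW//= mulr0 subr0.
  apply: (near_eq_is_derive (f := fun=> 0 : R)).
  near=> x; rewrite /flat ltNge ltW//=; near: x; exact: lt_nbhsl.
- pose Q (y : R) := y ^+ n * expR (- y).
  have dQ (y : R) : is_derive y 1 Q (n%:R * y ^+ n.-1 * expR (- y) - y ^+ n *
    expR (- y)).
    have dX : is_derive y 1 (fun y : R => y ^+ n) (n%:R * y ^+ n.-1).
      have -> : (fun y : R => y ^+ n) = id ^+ n.
        by apply/funext => z; rewrite exprfctE.
      by apply: is_derive_eq; rewrite -[_ *: _]/(_ * _) mulr1.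
    have dE : is_derive y 1 (expR \o -%R) (expR (- y) * -1).
      by apply: is_derive1_comp.
    have := @is_deriveM _ _ _ _ y 1 _ _ dX dE.
    by move/is_derive_eq; apply; rewrite /GRing.scale/=; ring.
  have dV : is_derive t 1 (fun x : R => x^-1) (- t ^- 2).
    have tn0 : id t != 0 by rewrite gt_eqF.
    have did : derivable (id : R -> R) t 1 by exact: derivable_id.
    apply: DeriveDef; first exact: (derivableV tn0 did).
    by rewrite (deriveV tn0 did) derive_id -[_ *: _]/(_ * _) mulr1.
  apply: (near_eq_is_derive (f := Q \o (fun x => x^-1))).
    near=> x; rewrite /flat /Q/= (_ : 0 < x)//; near: x; exact: lt_nbhsr.
  have := is_derive1_comp (dQ t^-1) dV; move/is_derive_eq; apply.
  rewrite /flat t0 -[t ^- 2]exprVn; case: n @Q dQ => [|n] _ _ /=.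
    by rewrite !mul0r !expr0; ring.
  by rewrite !exprS expr0; ring.
- have -> : flat n.+2 0 - n%:R * flat n.+1 0 = 0 :> R by rewrite /flat ltxx
  mulr0 subr0.
  set C : R := n.+2%:R ^+ n.+2; have C0 : 0 < C by rewrite exprn_gt0.
  have cv : (fun h : R => h^-1 *: ((flat n \o shift 0) (h *: 1) - flat n 0)) @
    0^' --> (0 : R).
    apply/cvgr0Pnorm_le => e e0; near=> h.
    have h0 : h != 0 by near: h; exact: nbhs_dnbhs_neq.
    have he : `|h| <= e / C.
      near: h; apply: (@pseudometric_normed_Zmodule.dnbhs0_le R R).
      by rewrite divr_gt0.
    have -> : (flat n \o shift 0) (h *: 1) - flat n 0 = flat n h.
      by rewrite /= addr0 {2}/flat ltxx subr0; congr (flat n _); exact: mulr1.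
    rewrite normrZ normrV ?unitfE// ler_pdivrMl ?normr_gt0//.
    apply: le_trans (flat_le n h) _; rewrite -/C -real_normK ?num_real//.
    rewrite expr2 mulrCA ler_pM2l ?normr_gt0// mulrC.
    by rewrite -ler_pdivlMr.
  by apply: DeriveDef; [exact: cvgP cv|exact: cvg_lim cv].
Unshelve. all: by end_near. Qed.

Lemma Ck_flat k n : Ck setT k (flat n).
Proof.
have df j x : differentiable (flat j) x.
  by apply/derivable1_diffP; have [] := is_derive_flat j x.
elim: k n => [|k IH] n.
  by move=> x _; apply: differentiable_continuous.
split=> [x _|v]; first exact: df.
have := Ck_mul openT (Ck_cst setT k v)
  (Ck_sub openT (IH n.+2) (Ck_mul openT (Ck_cst setT k n%:R) (IH n.+1))).
apply: Ck_ext => [|x _]; first exact: openT.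
have -> : 'D_v (flat n) x = v *: 'D_1 (flat n) x.
  rewrite !deriveE// -[v in LHS]mulr1 -[(v * 1)%R]/(v *: (1 : R)).
  by rewrite [LHS]linearZ.
by have [_ ->] := is_derive_flat n x.
Qed.

Lemma flat_gt0 t : 0 < t -> 0 < flat 0 t.
Proof. by move=> t0; rewrite /flat t0 expr0 mul1r expR_gt0. Qed.

Lemma flat_ge0 t : 0 <= flat 0 t.
Proof. by rewrite /flat; case: ifP => // _; rewrite expr0 mul1r expR_ge0. Qed.

Lemma flat0 n t : t <= 0 -> flat n t = 0.
Proof. by rewrite /flat ltNge => ->. Qed.

Lemma flat_nd t x : t <= x -> flat 0 t <= flat 0 x.
Proof.
move=> tx; have [t0|t0] := leP t 0; first by rewrite (flat0 _ t0) flat_ge0.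
have x0 : 0 < x by exact: lt_le_trans tx.
by rewrite /flat t0 x0 !expr0 !mul1r ler_expR lerN2 lef_pV2.
Qed.

(** A smooth step from 0 to 1.  It is nondecreasing because its numerator
    increases while the other term of the denominator decreases. *)
Definition step t := flat 0 t / (flat 0 t + flat 0 (1 - t)).

Lemma step_denom t : 0 < flat 0 t + flat 0 (1 - t).
Proof.
have [t0|t0] := leP t 0.
  by apply: ltr_wpDl; [exact: flat_ge0|apply: flat_gt0; lra].
by apply: ltr_wpDr; [exact: flat_ge0|exact: flat_gt0].
Qed.

Lemma smooth_step : smooth step.
Proof.
move=> k; have c1 : Ck setT k (fun t => flat 0 (1 - t)).
  apply: (@Ck_comp_real R R (fun t => 1 - t)) (Ck_flat k 0).
  apply: Ck_sub; first exact: openT.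
    exact: Ck_cst.
  exact: (@Ck_cfun _ _ (coords_real R) setT k tt).
apply: Ck_mul; [exact: openT|exact: Ck_flat|].
apply: Ck_inv; [exact: openT|by move=> t _; rewrite gt_eqF ?step_denom|].
by apply: Ck_add; [exact: openT|exact: Ck_flat|].
Qed.

Lemma step0 t : t <= 0 -> step t = 0.
Proof. by move=> t0; rewrite /step flat0// mul0r. Qed.

Lemma step1 t : 1 <= t -> step t = 1.
Proof.
move=> t1; rewrite /step [flat 0 (1 - t)]flat0 ?subr_le0// addr0 divff//.
by rewrite gt_eqF// flat_gt0// (lt_le_trans ltr01).
Qed.

Lemma step_nd t x : t <= x -> step t <= step x.
Proof.
move=> tx; rewrite /step ler_pdivrMr ?step_denom// mulrAC ler_pdivlMr
  ?step_denom//.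
rewrite !mulrDr [flat 0 x * flat 0 t]mulrC lerD2l.
have H : flat 0 (1 - x) <= flat 0 (1 - t) by apply: flat_nd; lra.
exact: ler_pM (flat_ge0 _) (flat_ge0 _) (flat_nd tx) H.
Qed.

(** A smooth bump supported within distance d of c. It is the difference of two
    steps shifted by one unit, so that the sum of the bumps centred at the
    points of a grid of mesh d telescopes. *)
Definition bump (d : R) (c t : R) := step ((t - c) / d + 1) - step ((t - c) /
  d).

Lemma smooth_bump d c : smooth (bump d c).
Proof.
move=> k; have aff : Ck setT k (fun t : R => (t - c) / d).
  apply: Ck_mul; [exact: openT| |exact: Ck_cst].
  apply: Ck_sub; [exact: openT| |exact: Ck_cst].
  exact: (@Ck_cfun _ _ (coords_real R) setT k tt).
apply: Ck_sub; first exact: openT.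
  apply: (@Ck_comp_real R R (fun t => (t - c) / d + 1)) (smooth_step k).
  by apply: Ck_add; [exact: openT| |exact: Ck_cst].
exact: (@Ck_comp_real R R (fun t => (t - c) / d)) (smooth_step k).
Qed.

Lemma bump_ge0 d c t : 0 <= bump d c t.
Proof. by rewrite subr_ge0 step_nd// lerDl. Qed.

Lemma bump_support d c t : 0 < d -> d < `|t - c| -> bump d c t = 0.
Proof.
move=> d0; rewrite ltr_normr => /orP[] h.
  have h1 : 1 < (t - c) / d by rewrite ltr_pdivlMr// mul1r.
  by rewrite /bump !step1 ?subrr//; lra.
have h1 : (t - c) / d < -1 by rewrite ltr_pdivrMr// mulN1r; lra.
by rewrite /bump !step0 ?subrr//; lra.
Qed.

Definition node (d : R) (N : nat) (i : 'I_(N.*2.+1)) : R := (i%:R - N%:R) * d.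

Lemma sum_bump d N t : 0 < d -> `|t| <= N%:R * d ->
  \sum_(i < N.*2.+1) bump d (node d i) t = 1.
Proof.
move=> d0 tN; pose g k := - step (t / d + N%:R + 1 - k%:R).
transitivity (\sum_(0 <= k < N.*2.+1) (g k.+1 - g k)).
  rewrite big_mkord; apply: eq_bigr => i _.
  have E : (t - node d i) / d = t / d + N%:R - i%:R.
    by rewrite /node; field; rewrite gt_eqF.
  rewrite /bump /g E opprK addrC; congr (- step _ + step _);
    first by rewrite -natr1; ring.
  by ring.
rewrite telescope_sumr// /g.
have [h1 h2] : - N%:R <= t / d /\ t / d <= N%:R.
  rewrite ler_pdivlMr// ler_pdivrMr// mulNr.
  by move: tN; rewrite ler_norml => /andP[].
rewrite step0 ?step1 ?oppr0 ?add0r ?opprK//; first lra.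
rewrite -natr1 -muln2 natrM; lra.
Qed.

End smooth_step.

(** * Approximation by elementary tensors *)
Section tensor.
Context {R : realType}.
Local Notation R4 := ((R * R) * (R * R))%type.

(** Continuity of (v, p) |-> g (p + v) at the points (0, p) is made uniform in
    p. *)
Lemma uniform_continuity (V : normedModType R) (K : set V) (g : V -> R) eta :
  compact K -> continuous g -> 0 < eta ->
  exists d, 0 < d /\ forall p q, K p -> `|q - p| <= d -> `|g q - g p| < eta.
Proof.
move=> cK cg eta0; pose psi (z : V * V) := g (z.2 + z.1).
have cpsi p : K p -> {for (0, p), continuous psi}.
  move=> _; apply: (@cvg_comp _ _ _ (fun z : V * V =>
    z.2 + z.1) g _ (nbhs (p + 0))).
    by apply: cvgD; [exact: cvg_snd|exact: cvg_fst].
  exact: cg.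
have /nbhs_ballP[d /= d0 Hd] := near_uniform_compact cK eta0 cpsi.
exists (d / 2); split; first by rewrite divr_gt0.
move=> p q Kp pq; have := Hd (q - p) _ p Kp.
rewrite /psi/= addr0 subrKC; apply.
rewrite -ball_normE/= sub0r normrN (le_lt_trans pq)//.
by rewrite ltr_pdivrMr// mulr2n mulrDr mulr1 ltrDl.
Qed.

Definition cube (B : R) : set R4 :=
  [set p | (`|p.1.1| <= B /\ `|p.1.2| <= B) /\ (`|p.2.1| <= B /\ `|p.2.2| <=
    B)].

Lemma cube_compact B : compact (cube B).
Proof.
pose I : set R := [set` `[- B, B]%R].
have -> : cube B = (I `*` I) `*` (I `*` I).
  by apply/seteqP; split=> -[[a b] [c d]] /=;
    rewrite /I/= !in_itv/= -!ler_norml.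
by apply: compact_setX; apply: compact_setX; exact: segment_compact.
Qed.

Variables (d : R) (N : nat).
Hypothesis d0 : 0 < d.
Let T := 'I_(N.*2.+1).
Let T4 := ((T * T) * (T * T))%type.

Definition node2 (k : T * T) : R * R := (node d k.1, node d k.2).
Definition node4 (k : T4) : R4 := (node2 k.1, node2 k.2).
Definition bump2 (k : T * T) (x : R * R) : R :=
  bump d (node d k.1) x.1 * bump d (node d k.2) x.2.
Definition bump4 (k : T4) (p : R4) : R := bump2 k.1 p.1 * bump2 k.2 p.2.

Lemma bump4_ge0 k p : 0 <= bump4 k p.
Proof. by rewrite !mulr_ge0 ?bump_ge0. Qed.

Lemma bump2_support k x : bump2 k x != 0 ->
  `|x.1 - (node2 k).1| <= d /\ `|x.2 - (node2 k).2| <= d.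
Proof.
rewrite mulf_eq0 negb_or => /andP[h1 h2]; split; rewrite leNgt; apply/negP => h.
  by move: h1; rewrite bump_support ?eqxx.
by move: h2; rewrite bump_support ?eqxx.
Qed.

(** The bound d <= m / 2 keeps the bumps centred in the annulus off the line
    a = 0. *)
Lemma bump2_annulus m M k x : m <= 1 -> d <= m / 2 -> annulus m M (node2 k) ->
  bump2 k x != 0 -> annulus (m / 2) (M + 1) x.
Proof.
move=> m1 dm [] + /andP[] + + /bump2_support[].
move: (node2 k) => [c1 c2]; case: x => x1 x2 /= c1M c2m c2M x1d x2d.
have t1 : `|x1| <= `|x1 - c1| + `|c1|.
  by rewrite (le_trans _ (ler_normD _ _))// subrK.
have t2 : `|x2| <= `|x2 - c2| + `|c2|.
  by rewrite (le_trans _ (ler_normD _ _))// subrK.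
have t3 : `|c2| <= `|x2 - c2| + `|x2|.
  by rewrite distrC (le_trans _ (ler_normD _ _))// subrK.
split=> /=; first lra.
by apply/andP; split; lra.
Qed.

Lemma sum_pair_mul (I J : finType) (f : I -> R) (g : J -> R) :
  \sum_(k : I * J) f k.1 * g k.2 = (\sum_i f i) * (\sum_j g j).
Proof.
rewrite big_distrlr/= [RHS]pair_bigA.
by apply: eq_bigr => -[].
Qed.

Lemma sum_bump4 B p : B <= N%:R * d -> cube B p -> \sum_k bump4 k p = 1.
Proof.
move=> BN [[p1 p2] [p3 p4]].
rewrite (sum_pair_mul (fun k => bump2 k p.1) (fun k => bump2 k p.2)).
rewrite /bump2.
rewrite (sum_pair_mul (fun i => bump d (node d i) p.1.1) (fun i =>
  bump d (node d i) p.1.2)).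
rewrite (sum_pair_mul (fun i => bump d (node d i) p.2.1) (fun i =>
  bump d (node d i) p.2.2)).
by rewrite !sum_bump ?mulr1//; exact: le_trans BN.
Qed.

(** The difference is an average of the differences g p - g (node4 k), with
    weights bump4 k p, and only the nodes close to p have a nonzero weight. *)
Lemma grid_approx_le (g : R4 -> R) B eta : B <= N%:R * d -> 0 <= eta ->
  (forall p q, cube B p -> `|q - p| <= d -> `|g q - g p| <= eta) ->
  forall p, cube B p -> `|g p - \sum_k g (node4 k) * bump4 k p| <= eta.
Proof.
move=> BN eta0 gd p Bp.
have -> : g p - \sum_k g (node4 k) * bump4 k p = \sum_k (g p - g (node4 k)) *
  bump4 k p.
  rewrite -[g p in LHS]mulr1 -(sum_bump4 BN Bp) mulr_sumr -sumrB.
  by apply: eq_bigr => k _; rewrite mulrBl.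
apply: le_trans (ler_norm_sum _ _ _) _.
rewrite -[leRHS]mulr1 -(sum_bump4 BN Bp) mulr_sumr; apply: ler_sum => k _.
rewrite normrM (ger0_norm (bump4_ge0 _ _)).
have [->|h0] := eqVneq (bump4 k p) 0; first by rewrite !mulr0.
rewrite ler_wpM2r ?bump4_ge0// distrC; apply: gd => //.
move: h0; rewrite mulf_eq0 negb_or =>
  /andP[/bump2_support[h1 h2] /bump2_support[h3 h4]].
by rewrite distrC !prod_normE/= !ge_max h1 h2 h3 h4.
Qed.

(** A point off the cube is at distance at least 1 from the support of g, and no
    bump attached to a node of the support reaches that far. *)
Lemma grid_approx_support (g : R4 -> R) m M p : m <= 1 -> d <= m / 2 ->
  (forall p, ~ annulus2 m M p -> g p = 0) -> ~ cube (M + 1) p ->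
  g p - \sum_k g (node4 k) * bump4 k p = 0.
Proof.
move=> m1 dm g0 nB.
have cA m' M' q : M' <= M + 1 -> annulus2 m' M' q -> cube (M + 1) q.
  move=> MM [[h1 /andP[_ h2]] [h3 /andP[_ h4]]].
  by split; split; exact: le_trans MM.
have -> : g p = 0 by apply: g0 => /cA H; apply: nB; apply: H; rewrite lerDl.
rewrite big1 ?subr0// => k _;
  have [/[dup]Ak [Ak1 Ak2]|nA] := pselect (annulus2 m M (node4 k));
  last by rewrite g0// mul0r.
have [->|] := eqVneq (bump4 k p) 0; first by rewrite mulr0.
rewrite mulf_eq0 negb_or => /andP[h1 h2]; exfalso; apply: nB.
apply: (cA (m / 2) (M + 1) p) => //.
by split; [exact: bump2_annulus m1 dm Ak1 h1|exact: bump2_annulus m1 dm Ak2 h2].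
Qed.

End tensor.

Section tensor_main.
Context {R : realType}.
Local Notation R4 := ((R * R) * (R * R))%type.

Lemma smooth_bump2 d N k : smooth (@bump2 R d N k).
Proof.
move=> j; apply: Ck_mul; first exact: openT.
  apply: (@Ck_comp_real _ _ (fun x : R * R => x.1)) (smooth_bump _ _ j).
  exact: (@Ck_cfun _ _ (coords2 R) setT j (inl tt)).
apply: (@Ck_comp_real _ _ (fun x : R * R => x.2)) (smooth_bump _ _ j).
exact: (@Ck_cfun _ _ (coords2 R) setT j (inr tt)).
Qed.

Lemma test_function_in_cstar_tensor (G : R4 -> R[i]) :
  test_function (@Gamma00 R) G -> in_cstar_tensor G.
Proof.
move=> [sG [K [cK KG GK]]] e e0.
have [sre sim] := ext0_smooth (@Gamma00_open R) cK KG GK sG.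
have [m [M [m0 m1 M1 KA]]] := compact_in_annulus2 cK KG.
set g := ext0 _ G in sre sim.
have g0 p : ~ annulus2 m M p -> g p = 0.
  move=> nA; rewrite /g /ext0; case: ifPn => // /set_mem Gp; apply: GK => //.
  by move=> /KA.
pose B := M + 1; have B0 : 0 < B by rewrite /B; lra.
pose eta := e / (8 * B ^+ 2).
have eta0 : 0 < eta by rewrite divr_gt0// mulr_gt0// exprn_gt0.
have cre : continuous (fun p => complex.Re (g p)) by move=> p;
  exact: (sre 0%N p I).
have cim : continuous (fun p => complex.Im (g p)) by move=> p;
  exact: (sim 0%N p I).
have [d1 [d10 H1]] := uniform_continuity (@cube_compact R B) cre eta0.
have [d2 [d20 H2]] := uniform_continuity (@cube_compact R B) cim eta0.
pose d := Num.min (Num.min d1 d2) (m / 2).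
have d0 : 0 < d by rewrite !lt_min d10 d20 divr_gt0.
have dd1 : d <= d1 by rewrite !ge_min lexx.
have dd2 : d <= d2 by rewrite !ge_min lexx orbT.
have dm : d <= m / 2 by rewrite !ge_min lexx orbT.
pose N := (Num.truncn (B / d)).+1.
have BN : B <= N%:R * d by rewrite -ler_pdivrMr// ltW// truncnS_gt.
pose T := 'I_(N.*2.+1); pose T4 := ((T * T) * (T * T))%type.
pose u (k : T4) (x : R * R) : R[i] := g (node4 d k) * (bump2 d k.1 x)%:C%C.
(* A node where g vanishes may lie so close to the line a = 0 that its bump
   meets this line; replacing the second factor by 0 at such nodes keeps it in
   D(Gamma_0). *)
pose v (k : T4) (y : R * R) : R[i] :=
  (if g (node4 d k) == 0 then 0 else 1) * (bump2 d k.2 y)%:C%C.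
have uvE k p : u k p.1 * v k p.2 = g (node4 d k) * (bump4 d k p)%:C%C.
  rewrite /u /v; case: eqP => [->|_]; first by rewrite !mul0r.
  by rewrite mul1r -mulrA -rmorphM.
have tf (c : R[i]) (k : T * T) : (c != 0 -> annulus m M (node2 d k)) ->
    test_function (@Gamma0 R) (fun x => c * (bump2 d k x)%:C%C).
  move=> cA; split.
    move=> j; have sh := smooth_bump2 d k j; have oG := @Gamma0_open R.
    have part (a : R) : Ck (@Gamma0 R) j (fun x => a * bump2 d k x).
      by apply: Ck_mul => //; [exact: Ck_cst|exact: Ck_subset sh].
    split; [apply: Ck_ext (part (complex.Re c)) => // x _|
            apply: Ck_ext (part (complex.Im c)) => // x _].
      by case: c {cA part} => c1 c2 /=; rewrite mulr0 subr0.
    by case: c {cA part} => c1 c2 /=; rewrite mulr0 add0r mulrC.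
  exists (annulus (m / 2) (M + 1)); split; first exact: annulus_compact.
    move=> [x1 x2] [_ /andP[/= h _]].
    by rewrite /Gamma0/= -normr_gt0 (lt_le_trans _ h)// divr_gt0.
  move=> x _ nx; have [->|/cA Ak] := eqVneq c 0; first by rewrite mul0r.
  have [->|h0] := eqVneq (bump2 d k x) 0; first by rewrite mulr0.
  by exfalso; apply: nx; exact: (bump2_annulus d0 m1 dm Ak h0).
have gA k : g (node4 d k) != 0 -> annulus2 m M (node4 d k).
  by move=> gk; apply: contrapT => /g0 /eqP; exact/negP.
exists #|{: T4}|, (fun i => u (enum_val i)), (fun i => v (enum_val i)); split.
- by move=> i; apply: tf => gk; have [] := gA _ _ gk.
- move=> i; apply: tf; have [_|gk _] := eqVneq (g (node4 d (enum_val i))) 0.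
    by rewrite eqxx.
  by have [] := gA _ _ gk.
have E p : \sum_(i < #|{: T4}|) u (enum_val i) p.1 * v (enum_val i) p.2 =
    \sum_(k : T4) g (node4 d k) * (bump4 d k p)%:C%C.
  rewrite (reindex (@enum_val T4 predT))/=; last exact/onW_bij/enum_val_bij.
  by apply: eq_bigr => i _; rewrite uvE.
have reE p : @Gamma00 R p ->
    complex.Re (G p - \sum_(i < #|{: T4}|) u (enum_val i) p.1 * v (enum_val i)
      p.2) =
    complex.Re (g p) - \sum_(k : T4) complex.Re (g (node4 d k)) * bump4 d k p.
  move=> Gp; have -> : g p = G p by rewrite /g /ext0 mem_set.
  rewrite E raddfB raddf_sum/=; congr (_ - _); apply: eq_bigr => k _.
  by case: (g _) => c1 c2 /=; rewrite mulr0 subr0.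
have imE p : @Gamma00 R p ->
    complex.Im (G p - \sum_(i < #|{: T4}|) u (enum_val i) p.1 * v (enum_val i)
      p.2) =
    complex.Im (g p) - \sum_(k : T4) complex.Im (g (node4 d k)) * bump4 d k p.
  move=> Gp; have -> : g p = G p by rewrite /g /ext0 mem_set.
  rewrite E raddfB raddf_sum/=; congr (_ - _); apply: eq_bigr => k _.
  by case: (g _) => c1 c2 /=; rewrite mulr0 add0r mulrC.
have re0 p : ~ annulus2 m M p -> complex.Re (g p) = 0 by move=> /g0 ->.
have im0 p : ~ annulus2 m M p -> complex.Im (g p) = 0 by move=> /g0 ->.
have re_out p : ~ cube B p -> complex.Re (g p) -
    \sum_(k : T4) complex.Re (g (node4 d k)) * bump4 d k p = 0.
  by move=> nB; exact: (@grid_approx_support R d N d0 _ m M p m1 dm re0 nB).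
have im_out p : ~ cube B p -> complex.Im (g p) -
    \sum_(k : T4) complex.Im (g (node4 d k)) * bump4 d k p = 0.
  by move=> nB; exact: (@grid_approx_support R d N d0 _ m M p m1 dm im0 nB).
apply: le_trans (@cstar_norm_le R B eta _ B0 eta0 _ _) _.
- move=> p Gp; rewrite reE// imE//; have [Bp|nB] := pselect (cube B p);
  last first.
    by rewrite re_out// im_out// normr0 ltW.
  split.
    apply: (@grid_approx_le R d N d0 (fun p =>
      complex.Re (g p)) B eta BN (ltW eta0)) => // q r Bq qr.
    by apply/ltW/H1 => //; exact: le_trans qr dd1.
  apply: (@grid_approx_le R d N d0 (fun p =>
    complex.Im (g p)) B eta BN (ltW eta0)) => // q r Bq qr.
  by apply/ltW/H2 => //; exact: le_trans qr dd2.
- move=> p Gp nB; have nC : ~ cube B p by move=> [[? _] [? _]]; apply: nB.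
  have := reE p Gp; rewrite re_out//; have := imE p Gp; rewrite im_out//.
  by case: (G p - _) => a b /= -> ->.
- rewrite lee_fin /eta le_eqVlt; apply/orP; left; apply/eqP; field.
  by rewrite gt_eqF.
Qed.

End tensor_main.

Theorem proposition6p7 (R : realType)
    (F : (R * R) * (R * R) -> R[i]) (f : R * R -> R[i])
    (hF : test_function (@Gamma00 R) F) (hf : test_function (@Gamma0 R) f) :
  [/\ exists eps : R, 0 < eps /\
        exists K : set ((R * R) * (R * R)),
          [/\ compact K, K `<=` @Gamma00 R &
              forall s : R, `|s| <= eps ->
                test_function (@Gamma00 R) (delta_hat s f F) /\
                vanishes_off (@Gamma00 R) K (delta_hat s f F)],
      cstar_norm (fun p => delta_hat s f F p - delta_hat 0 f F p)
        @[s --> 0^'] --> 0%E &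
      forall G : (R * R) * (R * R) -> R[i],
        test_function (@Gamma00 R) G -> in_cstar_tensor G].
Proof.
have [sF [KF [cKF KFG FKF]]] := hF; have [sf [Kf [cKf KfG fKf]]] := hf.
have smf := ext0_smooth (@Gamma0_open R) cKf KfG fKf sf.
have smF := ext0_smooth (@Gamma00_open R) cKF KFG FKF sF.
have [m1 [M1 [m10 m11 M11 A1]]] := compact_in_annulus cKf KfG.
have [m2 [M2 [m20 m21 M21 A2]]] := compact_in_annulus2 cKF KFG.
pose m := Num.min m1 m2; pose M := Num.max M1 M2.
have m0 : 0 < m by rewrite lt_min m10.
have mle1 : m <= 1 by rewrite ge_min m11.
have Mge1 : 1 <= M by rewrite le_max M11.
have f0 x : ~ annulus m M x -> ext0 (@Gamma0 R) f x = 0.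
  move=> nA; rewrite /ext0; case: ifPn => // /set_mem Gx; apply: fKf => //.
  by move=> /A1 /(@annulusS _ _ m _ M) H; apply/nA/H;
    rewrite ?ge_min ?le_max lexx.
have F0 x : ~ annulus2 m M x -> ext0 (@Gamma00 R) F x = 0.
  move=> nA; rewrite /ext0; case: ifPn => // /set_mem Gx; apply: FKF => //.
  by move=> /A2 /(@annulus2S _ _ m _ M) H; apply/nA/H;
    rewrite ?ge_min ?le_max lexx orbT.
pose eps := m ^+ 2 / (64 * M).
have eps0 : 0 < eps by rewrite divr_gt0 ?exprn_gt0 ?mulr_gt0 ?(lt_le_trans
  ltr01 Mge1).
pose K : set ((R * R) * (R * R)) := annulus2 (m / 2) (5 * (M / m)).
have cK : compact K by exact: annulus2_compact.
have KG : K `<=` @Gamma00 R by apply: annulus2_sub; rewrite divr_gt0.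
have B0 : 0 < 5 * (M / m).
  by rewrite mulr_gt0// divr_gt0// (lt_le_trans ltr01).
have supp s p : `|s| <= eps -> ~ K p -> delta_hat s f F p = 0.
  exact: delta_hat_support.
split; last exact: test_function_in_cstar_tensor.
- exists (eps / 2); split; first by rewrite divr_gt0.
  exists K; split=> // s se2.
  have se : `|s| < eps by apply: le_lt_trans se2 _;
    rewrite ltr_pdivrMr// mulr2n mulrDr mulr1 ltrDl.
  have van : vanishes_off (@Gamma00 R) K (delta_hat s f F).
    by move=> p _; apply: supp; exact: ltW.
  split=> //; split; last by exists K.
  exact: (delta_hat_smooth m0 mle1 Mge1 f0 F0 smf smF).
- pose C := 8 * (5 * (M / m)) ^+ 2.
  have C0 : 0 < C by rewrite mulr_gt0// exprn_gt0.
  (* C is the constant of cstar_norm_le for a box containing K. *)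
have small (e : R) : 0 < e -> \forall s \near (0 : R)^',
      (cstar_norm (fun p => (delta_hat s f F p - delta_hat 0 f F p)%R) <=
        e%:E)%E.
    move=> e0; have eta0 : 0 < e / C by rewrite divr_gt0.
    have := delta_hat_uniform m0 mle1 Mge1 f0 F0 smf smF eta0.
    move=> /nbhs_dnbhs; apply: filterS => s [se H].
    apply: le_trans (cstar_norm_le B0 eta0 _ _) _.
    + by move=> p _; exact: H.
    + move=> p _ nB; have nK : ~ K p by move=> [[? _] [? _]]; apply: nB.
      by rewrite !supp ?subrr// normr0 ltW.
    + rewrite lee_fin /C le_eqVlt; apply/orP; left; apply/eqP; field.
      by rewrite !gt_eqF//= (lt_le_trans ltr01).
  apply/fine_cvgP; split.
    apply: filterS (small 1 ltr01) => s s1.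
    by rewrite ge0_fin_numE ?cstar_norm_ge0// (le_lt_trans s1)// ltry.
  apply/cvgr0Pnorm_le => e e0; apply: filterS (small e e0) => s se /=.
  rewrite ger0_norm; last by rewrite fine_ge0// cstar_norm_ge0.
  rewrite -lee_fin fineK// ge0_fin_numE ?cstar_norm_ge0//.
  by rewrite (le_lt_trans se)// ltry.
Qed.
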